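(* Let $k\ge 1$ be an integer and let $A=(a_{ij})$ be a $2k\times 2k$ symmetric homogeneous matrix of non-negative integers, with trace $2d$. Then a general form $F$ of degree $d$ in four variables (i.e. a general $F\in \mathbb{C}[x_1,x_2,x_3,x_4]_d$) is the sum of the pfaffians of $k$ skew-symmetric $2k\times 2k$ matrices of forms in $\mathbb{C}[x_1,x_2,x_3,x_4]$, each having degree matrix $A$.
   Context: An integer matrix $A=(a_{ij})$ is called homogeneous if $a_{ij}+a_{lm}=a_{im}+a_{lj}$ for every choice of the indices $i,j,l,m$. A matrix $M=(F_{ij})$ of homogeneous forms has degree matrix $A=(a_{ij})$ if each $F_{ij}$ is homogeneous of degree $a_{ij}$; the zero polynomial is allowed as a form of any degree. If $A$ is symmetric and homogeneous of even size then its trace is even, and the pfaffian of a skew-symmetric matrix with degree matrix $A$ is a homogeneous form of degree $\mathrm{tr}(A)/2$ (or zero). ''A general form of degree $d$'' has a property if the property holds for all forms in some non-empty Zariski open subset of the vector space of forms of degree $d$. *)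

(* Defs.v *)
From HB Require Import structures.
From mathcomp Require Import all_boot all_order all_fingroup all_algebra.
From mathcomp Require Export complex mpoly.
From mathcomp Require Export reals.

Set Implicit Arguments.
Unset Strict Implicit.
Unset Printing Implicit Defensive.

Import GRing.Theory.
Local Open Scope ring_scope.

Definition homogeneous_mx (m n : nat) (A : 'M[nat]_(m, n)) : Prop :=
  forall i j l o, (A i j + A l o = A i o + A l j)%N.

(* The zero polynomial belongs to [d.-homog] for every d. *)
Definition has_degree_mx (r : nat) (K : nzRingType) (m n : nat)
    (A : 'M[nat]_(m, n)) (M : 'M[{mpoly K[r]}]_(m, n)) : Prop :=
  forall i j, M i j \is (A i j).-homog.

Definition skew_symmetric (R : nzRingType) (n : nat) (M : 'M[R]_n) : Prop :=
  M^T = - M.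

Lemma fst_idx_subproof (k : nat) (i : 'I_k) : (2 * i < 2 * k)%N.
Proof. by rewrite ltn_pmul2l. Qed.

Lemma snd_idx_subproof (k : nat) (i : 'I_k) : ((2 * i).+1 < 2 * k)%N.
Proof. by rewrite !mul2n ltn_Sdouble. Qed.

Definition fst_idx (k : nat) (i : 'I_k) : 'I_(2 * k) :=
  Ordinal (fst_idx_subproof i).

Definition snd_idx (k : nat) (i : 'I_k) : 'I_(2 * k) :=
  Ordinal (snd_idx_subproof i).

(* Each partition of 'I_(2 * k) into pairs {i_1, j_1}, ..., {i_k, j_k} is
   listed by exactly one permutation (i_1, j_1, ..., i_k, j_k) such that
   i_t < j_t for all t and i_1 < ... < i_k. *)
Definition perfect_matching (k : nat) (s : 'S_(2 * k)) : bool :=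
  [forall t : 'I_k, (s (fst_idx t) < s (snd_idx t))%N] &&
  [forall t : 'I_k, forall u : 'I_k,
     (t < u)%N ==> (s (fst_idx t) < s (fst_idx u))%N].

(* Meaningful for skew-symmetric M; only entries above the diagonal occur. *)
Definition pfaffian (R : comNzRingType) (k : nat) (M : 'M[R]_(2 * k)) : R :=
  \sum_(s : 'S_(2 * k) | perfect_matching s)
    (-1) ^+ s * \prod_(t < k) M (s (fst_idx t)) (s (snd_idx t)).

(* Linear changes of coordinates preserve polynomial functions, so the choice
   of the basis [vbasis fullv] is immaterial. *)
Definition vcoords (K : fieldType) (V : vectType K) (v : V) :
  'I_(\dim (fullv : {vspace V})) -> K := fun i => coord (vbasis fullv) i v.

Definition zariski_open (K : fieldType) (V : vectType K) (U : V -> Prop) :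
    Prop :=
  exists S : {mpoly K[\dim (fullv : {vspace V})]} -> Prop,
    forall v, U v <-> exists2 P, S P & P.@[vcoords v] != 0.

Definition holds_for_general (K : fieldType) (V : vectType K)
    (Q : V -> Prop) : Prop :=
  exists U : V -> Prop,
    [/\ zariski_open U, exists v, U v & forall v, U v -> Q v].

(* Main.v *)
Require Import Defs.
From HB Require Import structures.
From mathcomp Require Import all_boot all_order all_fingroup all_algebra.
From mathcomp Require Import closed_field boolp.
From mathcomp Require Import reals complex mpoly.
From mathcomp Require Import zify ring.

Set Implicit Arguments.
Unset Strict Implicit.
Unset Printing Implicit Defensive.

Import Order.TTheory GRing.Theory Num.Theory.
Local Open Scope ring_scope.

(** If the nonzero entries of a skew-symmetric matrix of size [2k] sit in an
    off-diagonal [k x k] block [B] and its negated transpose, the pfaffian is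
    [± \det B] ([pfaffian_skew_block]).  It therefore suffices to write a
    general form [F] of degree [d] as a sum of [k] determinants of [k x k]
    matrices of forms.  A homogeneous degree matrix is [rho i - gam j], which
    is how degrees are given below.

    The sums of [k] such determinants form the image of a polynomial map.  By
    quantifier elimination over an algebraically closed field, this image
    either contains a nonempty principal open set or lies in a hypersurface
    ([image_dichotomy]).  The second case is impossible as soon as the
    differential is surjective at one point: restrict the equation of the
    hypersurface to curves through that point and look at its lowest-degree
    part ([mpoly_eq0_of_curves]).  The differential at [(M_t)] sends [(U_t)] to
    [\sum_t \sum_(i, j) U_t i j * cofactor (M_t) i j], so all that is left is
    to find [M_1, ..., M_k] whose cofactors generate an ideal containing every
    form of degree [d] ([fill_all_rows]).

    Such matrices are built by removing one variable at a time ([fill_step]).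
    Suppose that one row [a_t] is chosen in each matrix, that the matrices with
    these rows lowered by one degree do the job in degree [e - 1], and that
    modulo the variable [v] the cofactors along the chosen rows alone do it in
    degree [e].  Multiply the rows [a_t] by [v]: the other cofactors
    get multiplied by [v], those along the chosen rows are unchanged.  A form of
    degree [e] is then treated modulo [v] first, and the quotient by [v] next.
    Both requirements can be met by the same matrices since each of them, once
    satisfied somewhere, is satisfied generically ([fill_line],
    [fill_common]).  The step is used at two levels.

    With four variables, one lowers in all matrices the row of largest degree,
    and has to know that in three variables the cofactors of [k] matrices along
    that one row suffice ([fill_one_row]).  With three variables one goes
    through the [n] rows in turn.  At stage [s] the matrix number [s] keeps all
    its fixed rows and has its free row lowered, while every other matrix has
    a fixed row lowered.  So after [n] stages every row of every matrix has been
    lowered exactly once, and at stage [s] two variables remain and the single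
    matrix number [s] has to do the work.  It can be taken bidiagonal with
    powers of the two variables as entries, so that its maximal minors are
    monomials ([fill_bidiagonal]).  Whenever an entry of degree 0 appears it is
    set to 1 and the size drops by one ([fill_border]). *)

(** * Forms of integer degree *)
Section Forms.
Variables (r : nat) (K : nzRingType).
Implicit Types (p q : {mpoly K[r]}) (z : int).

(** Degrees are integers, so that the degrees [rho i - gam j] of the entries of a
    matrix add up without side conditions; a form of negative degree is 0. *)
Definition is_form z p : bool := all [pred m | (mdeg m)%:Z == z] (msupp p).

Lemma is_formP z p :
  reflect {in msupp p, forall m, (mdeg m)%:Z = z} (is_form z p).
Proof. by apply: (iffP allP) => h m /h /eqP. Qed.

Lemma is_form_dhomog (d : nat) p : is_form d p = (p \is d.-homog).
Proof. by []. Qed.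

Lemma is_form_coef0 z p m : is_form z p -> (mdeg m)%:Z != z -> p@_m = 0.
Proof.
move=> /is_formP hp md; apply/eqP; rewrite mcoeff_eq0.
by apply: contra md => /hp ->.
Qed.

Lemma is_form0 z : is_form z 0.
Proof. by rewrite /is_form msupp0. Qed.

Lemma is_form1 : is_form 0 1.
Proof. by rewrite /is_form msupp1 /= mdeg0. Qed.

Lemma is_formD z p q : is_form z p -> is_form z q -> is_form z (p + q).
Proof.
move=> /is_formP hp /is_formP hq; apply/is_formP => m /msuppD_le.
by rewrite mem_cat => /orP[/hp|/hq].
Qed.

Lemma is_formN z p : is_form z p -> is_form z (- p).
Proof. by rewrite /is_form (perm_all _ (msuppN _)). Qed.

Lemma is_formB z p q : is_form z p -> is_form z q -> is_form z (p - q).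
Proof. by move=> hp hq; apply: is_formD => //; apply: is_formN. Qed.

Lemma is_form_sum z (I : Type) (s : seq I) (P : pred I) (F : I -> {mpoly K[r]}) :
  (forall i, P i -> is_form z (F i)) -> is_form z (\sum_(i <- s | P i) F i).
Proof.
by move=> h; elim/big_ind: _ => //; [apply: is_form0|move=> *; apply: is_formD].
Qed.

Lemma is_formM z1 z2 p q :
  is_form z1 p -> is_form z2 q -> is_form (z1 + z2) (p * q).
Proof.
move=> /is_formP hp /is_formP hq; apply/is_formP => m.
move=> /msuppM_le /allpairsP [[m1 m2] /= [h1 h2 ->]].
by rewrite mdegD PoszD (hp _ h1) (hq _ h2).
Qed.

Lemma is_formZ z c p : is_form z p -> is_form z (c *: p).
Proof. by move=> /is_formP hp; apply/is_formP => m /msuppZ_le /hp. Qed.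

Lemma is_formX m : is_form (mdeg m)%:Z 'X_[m].
Proof. by rewrite /is_form msuppX /= eqxx. Qed.

Lemma is_formU i : is_form 1 'X_i.
Proof. by have := is_formX (mnm1 i); rewrite mdeg1. Qed.

Lemma is_form_sign z b p : is_form z p -> is_form z ((-1) ^+ b * p).
Proof.
by move=> hp; rewrite -signr_odd mulr_sign; case: ifP => // _; apply: is_formN.
Qed.

Definition form_part z p : {mpoly K[r]} :=
  \sum_(m <- msupp p | (mdeg m)%:Z == z) p@_m *: 'X_[m].

Lemma is_form_part z p : is_form z (form_part z p).
Proof. by apply: is_form_sum => m /eqP <-; apply/is_formZ/is_formX. Qed.

Lemma form_part_off_degree z p m : m \in msupp (p - form_part z p) -> (mdeg m)%:Z != z.
Proof.
rewrite {1}[p]mpolyE (bigID (fun m => (mdeg m)%:Z == z)) /= addrC addrK.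
suff: {in msupp (\sum_(m <- msupp p | (mdeg m)%:Z != z) p@_m *: 'X_[m]),
   forall m, (mdeg m)%:Z != z} by apply.
elim/big_ind: _ => [|a b ha hb m'|m0 h0 m'].
- by move=> m'; rewrite msupp0.
- by move=> /msuppD_le; rewrite mem_cat => /orP[/ha|/hb].
- by move=> /msuppZ_le; rewrite msuppX inE => /eqP ->.
Qed.

Lemma is_form_off_degree_eq0 z p : is_form z p ->
  (forall m, m \in msupp p -> (mdeg m)%:Z != z) -> p = 0.
Proof.
move=> /is_formP hp ho; apply/eqP; rewrite -msupp_eq0; case E: (msupp p) => [//|m s].
have min : m \in msupp p by rewrite E mem_head.
by have := ho _ min; rewrite (hp _ min) eqxx.
Qed.

End Forms.

(** * Ideals containing all forms of a given degree *)
Section Fill.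
Variables (r : nat) (K : fieldType).
Local Notation S := {mpoly K[r]}.

Definition fill (I : finType) (g : I -> S) (e : int) : Prop :=
  forall f, is_form e f -> exists c : I -> S, f = \sum_a c a * g a.

(** The definition of [fill] leaves the degrees of the coefficients free; when the
    generators are forms, only the components of the right degree matter. *)
Lemma fill_forms (I : finType) (g : I -> S) (z : I -> int) e :
  (forall a, is_form (z a) (g a)) -> fill g e ->
  forall f, is_form e f ->
  exists2 c : I -> S, (forall a, is_form (e - z a) (c a)) & f = \sum_a c a * g a.
Proof.
move=> hg fg f hf; have [c fE] := fg f hf.
exists (fun a => form_part (e - z a) (c a)); first by move=> a; apply: is_form_part.
apply/eqP; rewrite -subr_eq0; apply/eqP.
apply: (@is_form_off_degree_eq0 _ _ e).
  apply: is_formB => //; apply: is_form_sum => a _.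
  by rewrite -[X in is_form X _](subrK (z a)); apply: is_formM => //; apply: is_form_part.
rewrite fE -sumrB => m.
suff: {in msupp (\sum_i (c i * g i - form_part (e - z i) (c i) * g i)),
  forall m, (mdeg m)%:Z != e} by apply.
elim/big_ind: _ => [|a b ha hb m'|a _ m'].
- by move=> m'; rewrite msupp0.
- by move=> /msuppD_le; rewrite mem_cat => /orP[/ha|/hb].
rewrite -mulrBl => /msuppM_le /allpairsP [[m1 m2] /= [h1 h2 ->]].
rewrite mdegD PoszD (is_formP _ _ (hg _) _ h2) -(inj_eq (@subIr _ (z a))) addrK.
exact: form_part_off_degree h1.
Qed.

Lemma fill_monomials (I : finType) (g : I -> S) e :
  (forall m, (mdeg m)%:Z = e -> exists c : I -> S, 'X_[m] = \sum_a c a * g a) ->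
  fill g e.
Proof.
move=> h f /is_formP hf; rewrite [f]mpolyE big_seq.
elim/big_ind: _ => [|p q [c1 ->] [c2 ->]|m /hf /h [c ->]].
- by exists (fun=> 0); rewrite big1 // => a _; rewrite mul0r.
- exists (fun a => c1 a + c2 a); rewrite -big_split.
  by apply: eq_bigr => a _; rewrite mulrDl.
- exists (fun a => f@_m *: c a); rewrite scaler_sumr.
  by apply: eq_bigr => a _; rewrite scalerAl.
Qed.

Lemma coef_horner_mpoly (H : {poly S}) (s : K) m :
  (H.[s%:MP])@_m = (map_poly (mcoeff m) H).[s].
Proof.
rewrite horner_coef raddf_sum (@horner_coef_wide _ (size H)) ?size_poly //.
apply: eq_bigr => i _; rewrite coef_poly ltn_ord.
by rewrite -rmorphXn /= mulrC mcoeffCM mulrC.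
Qed.

(** For each monomial of degree [e] the membership at parameter [0], with its
    coefficients kept fixed, gives a combination of the deformed generators that
    depends polynomially on [s].  The square matrix expressing these
    combinations in the monomials is the identity at [0], so its determinant is
    the required [q]. *)
Lemma fill_open (I : finType) (G : I -> {poly S}) (z : I -> int) e :
  (forall s a, is_form (z a) (G a).[s%:MP]) -> fill (fun a => (G a).[0]) e ->
  exists2 q : {poly K}, q.[0] != 0 &
    forall s, q.[s] != 0 -> fill (fun a => (G a).[s%:MP]) e.
Proof.
case: e => [d|d]; last first.
  move=> _ _; exists 1; first by rewrite hornerC oner_neq0.
  move=> s _ f hf; exists (fun=> 0); rewrite big1; last by move=> a _; rewrite mul0r.
  by apply: (is_form_off_degree_eq0 hf) => m _.
move=> hG f0.
pose T := {m : 'X_{1..r < d.+1} | mdeg m == d}.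
pose mon (i : 'I_#|{: T}|) : 'X_{1..r} := bmnm (val (enum_val i)).
have mdeg_mon i : mdeg (mon i) = d by rewrite /mon; case: (enum_val i) => m /= /eqP.
have /fin_all_exists[c hc] (i : 'I_#|{: T}|) : exists ci : I -> S,
   (forall a, is_form (d%:Z - z a) (ci a)) /\ 'X_[mon i] = \sum_a ci a * (G a).[0].
  have hg0 a : is_form (z a) (G a).[0] by have := hG 0 a; rewrite mpolyC0.
  have hX : is_form d 'X_[K, mon i] by have := is_formX K (mon i); rewrite mdeg_mon.
  by have [c c1 c2] := fill_forms hg0 f0 hX; exists c.
pose H i : {poly S} := \sum_a (c i a)%:P * G a.
have HE i s : (H i).[s%:MP] = \sum_a c i a * (G a).[s%:MP].
  by rewrite horner_sum; apply: eq_bigr => a _; rewrite hornerCM.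
have H_form i s : is_form d (H i).[s%:MP].
  rewrite HE; apply: is_form_sum => a _.
  by rewrite -[X in is_form X _](subrK (z a)); apply: is_formM => //; apply: (hc i).1.
pose P : 'M[{poly K}]_#|{: T}| := \matrix_(i, j) map_poly (mcoeff (mon j)) (H i).
pose Ps s := map_mx (horner_eval s) P.
have PsE s i j : Ps s i j = ((H i).[s%:MP])@_(mon j).
  by rewrite !mxE coef_horner_mpoly.
have mon_inj : injective mon.
  by move=> i j /val_inj /val_inj /enum_val_inj.
have qE s : (\det P).[s] = \det (Ps s) by rewrite det_map_mx.
exists (\det P).
  rewrite qE (_ : Ps 0 = 1%:M) ?det1 ?oner_neq0 //.
  apply/matrixP => i j; rewrite PsE mpolyC0 mxE.
  have := HE i 0; rewrite mpolyC0 -(hc i).2 => ->.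
  by rewrite mcoeffX (inj_eq mon_inj).
move=> s qs f hf.
have uP : Ps s \in unitmx by rewrite unitmxE -qE unitfE.
pose fr : 'rV[K]_#|{: T}| := \row_j f@_(mon j).
pose l := fr *m invmx (Ps s).
have lE : l *m Ps s = fr by rewrite mulmxKV.
exists (fun a => \sum_i l 0 i *: c i a).
rewrite (eq_bigr (fun a => \sum_i l 0 i *: (c i a * (G a).[s%:MP]))); last first.
  by move=> a _; rewrite mulr_suml; apply: eq_bigr => i _; rewrite scalerAl.
rewrite exchange_big /= (eq_bigr (fun i => l 0 i *: (H i).[s%:MP])); last first.
  by move=> i _; rewrite HE scaler_sumr.
apply/mpolyP => m; have [md|md] := eqVneq (mdeg m) d; last first.
  have off p : is_form d p -> p@_m = 0.
    by move=> hp; apply: is_form_coef0 hp _.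
  by rewrite !off //; apply: is_form_sum => i _; apply: is_formZ.
have bm : (mdeg m < d.+1)%N by rewrite md.
have mT : mdeg (BMultinom bm) == d by apply/eqP.
pose j := enum_rank (exist _ (BMultinom bm) mT : T).
have -> : m = mon j by rewrite /mon enum_rankK.
have := congr1 (fun A : 'rV_#|{: T}| => A 0 j) lE; rewrite !mxE => <-.
by rewrite raddf_sum; apply: eq_bigr => i _; rewrite /= mcoeffZ PsE.
Qed.

End Fill.

(** * Cofactors in families of graded matrices *)
Section FormsDet.
Variables (r : nat) (K : comNzRingType).
Local Notation S := {mpoly K[r]}.

Lemma is_form_prod (I : finType) (z : I -> int) (F : I -> S) :
  (forall i, is_form (z i) (F i)) -> is_form (\sum_i z i) (\prod_i F i).
Proof.
move=> h; apply: (big_rec2 (fun z p => is_form z p)); first exact: is_form1.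
by move=> i z' p _ hp; apply: is_formM.
Qed.

Lemma is_form_det n (M : 'M[S]_n) (rho gam : 'I_n -> int) :
  (forall i j, is_form (rho i - gam j) (M i j)) ->
  is_form (\sum_i rho i - \sum_j gam j) (\det M).
Proof.
move=> h; apply: is_form_sum => s _; apply: is_form_sign.
rewrite [X in _ - X](reindex_inj (@perm_inj _ s)) -sumrB.
by apply: is_form_prod => i.
Qed.

Lemma is_form_cofactor n (M : 'M[S]_n) (rho gam : 'I_n -> int) i j :
  (forall a b, is_form (rho a - gam b) (M a b)) ->
  is_form (\sum_a rho a - \sum_b gam b - (rho i - gam j)) (cofactor M i j).
Proof.
case: n => [|n] in M rho gam i j *; first by case: i.
move=> h; apply: is_form_sign; rewrite (bigD1_ord i) // (bigD1_ord j) //=.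
rewrite (_ : _ - _ = \sum_a rho (lift i a) - \sum_b gam (lift j b)); last first.
  ring.
by apply: is_form_det => a b; rewrite !mxE.
Qed.

End FormsDet.

Lemma cofactor_scale_row (R : comNzRingType) n (M N : 'M[R]_n) a x i j :
  (forall b, N a b = x * M a b) ->
  (forall i' b, i' != a -> N i' b = M i' b) ->
  cofactor N i j = if i == a then cofactor M i j else x * cofactor M i j.
Proof.
case: n => [|n] in M N a i j *; first by case: a.
move=> Na Nx.
rewrite /cofactor mulrCA; have [ia|ia] := eqVneq i a.
  congr (_ * \det _); apply/matrixP => k l; rewrite !mxE Nx //.
  by rewrite -ia eq_sym neq_lift.
congr (_ * _); have [b bE] : exists b, a = lift i b.
  by case: (unlift_some ia) => b ->; exists b.
pose M' := row' i (col' j M); pose N' := row' i (col' j N).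
rewrite (@determinant_multilinear _ _ N' M' M' b x 0) ?mul0r ?addr0 //.
- by apply/rowP => l; rewrite !mxE -bE Na mul0r addr0.
- apply/matrixP => k l; rewrite !mxE Nx // bE (inj_eq lift_inj).
  by rewrite eq_sym neq_lift.
- apply/matrixP => k l; rewrite !mxE Nx // bE (inj_eq lift_inj).
  by rewrite eq_sym neq_lift.
Qed.

Lemma horner_cofactor (R : comNzRingType) n (P : 'M[{poly R}]_n) i j (x : R) :
  (cofactor P i j).[x] = cofactor (\matrix_(a, b) (P a b).[x]) i j.
Proof.
rewrite -/(horner_eval x (cofactor P i j)) -cofactor_map_mx /=.
by congr cofactor; apply/matrixP => a b; rewrite !mxE.
Qed.

Lemma exists_nonroot (K : numFieldType) (q : {poly K}) :
  q != 0 -> exists s, q.[s] != 0.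
Proof.
move=> q0; pose rs := [seq i%:R : K | i <- iota 0 (size q)].
have /allPn[s _ hs] : ~~ all (root q) rs.
  apply/negP => h; have := max_poly_roots q0 h.
  rewrite map_inj_uniq ?iota_uniq; last by move=> i j /eqP; rewrite eqr_nat => /eqP.
  by rewrite size_map size_iota ltnn => /(_ isT).
by exists s.
Qed.

Section Families.
Variables (r : nat) (K : numFieldType) (c n : nat).
Local Notation S := {mpoly K[r]}.
Local Notation idx := ('I_c * 'I_n * 'I_n)%type.
Implicit Types (V : {set 'I_r}) (D : {set idx}) (M : 'I_c -> 'M[S]_n).

(** The family [M] consists of [c] matrices, and [D] selects the cofactors
    in use as triples (matrix, row, column); the variables in [V] are added in
    order to work modulo them without leaving the polynomial ring. *)
Definition gens V D M (a : idx + 'I_r) : S :=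
  match a with
  | inl p => if p \in D then cofactor (M p.1.1) p.1.2 p.2 else 0
  | inr v => if v \in V then 'X_v else 0
  end.

Definition graded (rho : 'I_c -> 'I_n -> int) (gam : 'I_n -> int) M :=
  forall t i j, is_form (rho t i - gam j) (M t i j).

Definition gens_deg (rho : 'I_c -> 'I_n -> int) (gam : 'I_n -> int)
    (a : idx + 'I_r) : int :=
  match a with
  | inl p => \sum_i rho p.1.1 i - \sum_j gam j - (rho p.1.1 p.1.2 - gam p.2)
  | inr _ => 1
  end.

Lemma is_form_gens rho gam V D M : graded rho gam M ->
  forall a, is_form (gens_deg rho gam a) (gens V D M a).
Proof.
move=> hM [[[t i] j]|v] /=; case: ifP => _; try exact: is_form0; last exact: is_formU.
by apply: is_form_cofactor => a b; apply: hM.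
Qed.

Definition line M N s t : 'M[S]_n := M t + s%:MP *: (N t - M t).

Lemma graded_line rho gam M N s :
  graded rho gam M -> graded rho gam N -> graded rho gam (line M N s).
Proof.
move=> hM hN t i j; rewrite !mxE mul_mpolyC.
by apply: is_formD => //; apply/is_formZ/is_formB.
Qed.

Lemma fill_line rho gam M N V D e : graded rho gam M -> graded rho gam N ->
  fill (gens V D M) e ->
  exists2 q : {poly K}, q != 0 &
    forall s, q.[s] != 0 -> fill (gens V D (line M N s)) e.
Proof.
move=> hM hN fM.
pose P t := map_mx polyC (M t) + 'X *: map_mx polyC (N t - M t).
pose G (a : idx + 'I_r) : {poly S} := match a with
  | inl p => if p \in D then cofactor (P p.1.1) p.1.2 p.2 else 0
  | inr v => if v \in V then ('X_v)%:P else 0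
  end.
have GE s a : (G a).[s%:MP] = gens V D (line M N s) a.
  case: a => [p|v] /=; case: ifP => _; rewrite ?hornerC //.
  rewrite horner_cofactor.
  suff -> : \matrix_(i, j) (P p.1.1 i j).[s%:MP] = line M N s p.1.1 by [].
  apply/matrixP => i j; rewrite !mxE hornerD hornerC.
  by rewrite mulrC hornerCM hornerX mulrC.
have line0 t : line M N 0 t = M t by rewrite /line mpolyC0 scale0r addr0.
have gen0 a : (G a).[0] = gens V D M a.
  have := GE 0 a; rewrite mpolyC0 => ->; case: a => [p|v]; last by [].
  by rewrite /gens line0.
have [||q q0 hq] := @fill_open _ _ _ G (gens_deg rho gam) e.
- by move=> s a; rewrite GE; apply/is_form_gens/graded_line.
- by move=> f /fM [u ->]; exists u; apply: eq_bigr => a _; rewrite gen0.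
exists q; first by apply: contraNneq q0 => ->; rewrite horner0.
move=> s /hq h f /h [u ->]; exists u.
by apply: eq_bigr => a _; rewrite GE.
Qed.

Lemma eq_fill V D M N e : M =1 N -> fill (gens V D M) e -> fill (gens V D N) e.
Proof.
move=> MN h f /h [u ->]; exists u; apply: eq_bigr => -[p|v] _; last by [].
by rewrite /gens MN.
Qed.

(** On the line joining [M] to [N] either property holds outside finitely many
    points, because it holds at one of the two ends. *)
Lemma fill_common rho gam M N V1 D1 e1 V2 D2 e2 :
  graded rho gam M -> graded rho gam N ->
  fill (gens V1 D1 M) e1 -> fill (gens V2 D2 N) e2 ->
  exists L, [/\ graded rho gam L, fill (gens V1 D1 L) e1
                & fill (gens V2 D2 L) e2].
Proof.
move=> hM hN /(fill_line hM hN) [q1 q1n hq1] /(fill_line hN hM) [q2 q2n hq2].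
have q2'n : q2 \Po (1 - 'X) != 0.
  apply: contraNneq q2n => h; rewrite -[q2]comp_polyXr.
  have -> : 'X = (1 - 'X) \Po (1 - 'X) :> {poly K}.
    by rewrite comp_polyB comp_polyC comp_polyX opprB addrC subrK.
  by rewrite comp_polyA h comp_poly0.
have [s] := exists_nonroot (mulf_neq0 q1n q2'n).
rewrite hornerM mulf_eq0 negb_or horner_comp !hornerE => /andP[s1 s2].
exists (line M N s); split; [exact: graded_line|exact: hq1|].
apply: eq_fill (hq2 _ s2) => t; rewrite /line rmorphB rmorph1.
by apply/matrixP => i j; rewrite !mxE; ring.
Qed.

(** The reduction by one variable: [rho'] lowers row [a t] of matrix [t], and the
    final matrices are obtained from the common solution of the two hypotheses
    by multiplying these rows by ['X_v]. *)
Lemma fill_step rho gam V D e (v : 'I_r) (a : 'I_c -> 'I_n) :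
  let rho' t i := rho t i - (i == a t)%:Z in
  (exists2 M, graded rho' gam M & fill (gens V D M) (e - 1)) ->
  (exists2 M, graded rho' gam M &
     fill (gens (v |: V) [set p in D | p.1.2 == a p.1.1] M) e) ->
  exists2 M, graded rho gam M & fill (gens V D M) e.
Proof.
move=> rho' [M1 g1 f1] [M2 g2 f2].
have [M [gM {}f1 {}f2]] := fill_common g1 g2 f1 f2.
pose N t : 'M_n := \matrix_(i, j) (if i == a t then 'X_v * M t i j else M t i j).
exists N.
  move=> t i j; rewrite mxE; have := gM t i j; rewrite /rho'.
  case: eqP => _ h; last by rewrite subr0 in h.
  have -> : rho t i - gam j = 1 + (rho t i - true%:Z - gam j) by lia.
  by apply: is_formM => //; apply: is_formU.
have cofN t i j : cofactor (N t) i j =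
    if i == a t then cofactor (M t) i j else 'X_v * cofactor (M t) i j.
  apply: cofactor_scale_row => [b|i' b h]; rewrite mxE ?eqxx //.
  by rewrite (negbTE h).
move=> f hf; have [u uh ->] := fill_forms (is_form_gens _ _ gM) f2 hf.
have [w wE] := f1 _ (uh (inr v)).
rewrite big_sumType in wE.
rewrite big_sumType.
simpl in wE.
simpl.
exists (fun b => match b with
  | inl p => (if p.1.2 == a p.1.1 then u b + 'X_v * w b else w b)
  | inr v' => (if v' == v then 0 else u b) + 'X_v * w b end).
rewrite big_sumType /=.
rewrite [X in _ + X = _](bigD1 v) //= setU11 {}wE.
rewrite [in RHS](eq_bigr (fun v' => (if v' == v then 0 else
    u (inr v') * (if v' \in v |: V then 'X_v' else 0)) +
   'X_v * (w (inr v') * (if v' \in V then 'X_v' else 0)))); last first.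
  move=> v' _; rewrite mulrDl mulrA; congr (_ + _).
  by case: eqP => [_|/eqP h]; rewrite ?mul0r // !inE (negbTE h).
rewrite [in RHS](eq_bigr (fun p : idx => u (inl p) * (if
    p \in [set p in D | p.1.2 == a p.1.1] then cofactor (M p.1.1) p.1.2 p.2
    else 0) + 'X_v * (w (inl p) * 
     (if p \in D then cofactor (M p.1.1) p.1.2 p.2 else 0)))); last first.
  move=> p _; rewrite !inE cofN.
  by case: (p \in D); case: eqP => _ //=; rewrite ?mulr0 ?addr0 //; ring.
rewrite !big_split /= -!mulr_sumr [X in _ = _ + (X + _)](bigD1 v) //= eqxx add0r.
rewrite [X in _ = _ + (X + _)](eq_bigr (fun v' => u (inr v') *
  (if v' \in v |: V then 'X_v' else 0))); last by move=> v' /negbTE ->.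
ring.
Qed.

End Families.

(** * Bidiagonal and bordered matrices *)
Section Bidiagonal.
Variables (R : idomainType) (m : nat) (i0 : 'I_m.+1) (xs ys : 'I_m -> R).

Definition bidiagonal : 'M[R]_m.+1 :=
  \matrix_(i, j) if unlift i0 i is Some l then
    if j == l :> nat then xs l else if j == l.+1 :> nat then ys l else 0
  else 0.

Lemma bidiagonal_cofactor0 :
  cofactor bidiagonal i0 ord0 = (-1) ^+ i0 * \prod_l ys l.
Proof.
rewrite /cofactor addn0 det_trig; last first.
  apply/is_trig_mxP => k l kl; rewrite !mxE liftK /= /bump /= add1n.
  by rewrite !gtn_eqF // (ltn_trans kl).
congr (_ * _); apply: eq_bigr => l _; rewrite !mxE liftK /= /bump /= add1n.
by rewrite eqxx gtn_eqF.
Qed.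

(** Row [lift i0 l] is orthogonal to the vector of cofactors along row [i0], and
    has only two nonzero entries.  This recurrence determines all the cofactors
    from the first one, which is a triangular determinant. *)
Lemma bidiagonal_cofactorS (l : 'I_m) :
  ys l * cofactor bidiagonal i0 (lift ord0 l) =
  - (xs l * cofactor bidiagonal i0 (widen_ord (leqnSn m) l)).
Proof.
apply/eqP; rewrite -addr_eq0; apply/eqP.
have := congr1 (fun A : 'M_m.+1 => A (lift i0 l) i0) (mul_mx_adj bidiagonal).
rewrite !mxE eq_sym (negbTE (neq_lift _ _)) mulr0n => <-.
rewrite (bigD1 (lift ord0 l)) //= (bigD1 (widen_ord (leqnSn m) l)); last first.
  by rewrite /= -val_eqE /= /bump /=; lia.
rewrite big1 => [|j /andP[]]; last first.
  rewrite -!val_eqE /= /bump /= add1n mxE liftK => h1 h2.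
  by rewrite (negbTE h1) (negbTE h2) mul0r.
rewrite /= addr0 !mxE liftK /= /bump /= add1n eqxx.
by rewrite gtn_eqF ?eqxx.
Qed.

Lemma bidiagonal_cofactor (j : 'I_m.+1) : (forall l, ys l != 0) ->
  cofactor bidiagonal i0 j = (-1) ^+ (i0 + j) *
    ((\prod_(l < m | (l < j)%N) xs l) * \prod_(l < m | (j <= l)%N) ys l).
Proof.
move=> ys0; case: j => j /=; elim: j => [|j IHj] hj.
  rewrite (_ : Ordinal hj = ord0); last exact: val_inj.
  by rewrite bidiagonal_cofactor0 addn0 [X in _ = _ * (X * _)]big_pred0 // mul1r.
have jm : (j < m)%N by [].
have {}IHj := IHj (ltnW hj).
have := bidiagonal_cofactorS (Ordinal jm).
rewrite (_ : lift _ _ = Ordinal hj); last exact: val_inj.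
rewrite (_ : widen_ord _ _ = Ordinal (ltnW hj)); last exact: val_inj.
move=> h; apply: (mulfI (ys0 (Ordinal jm))); rewrite {}h.
rewrite IHj addnS exprS (bigD1 (P := fun l : 'I_m => (j <= l)%N) (Ordinal jm)) //=.
rewrite [in RHS](bigD1 (Ordinal jm)) //=.
rewrite [X in _ = _ * (_ * (_ * X * _))](eq_bigl (fun l : 'I_m => (l < j)%N)); last first.
  by move=> l; rewrite -val_eqE /=; lia.
rewrite [X in _ = _ * (_ * (_ * X))](eq_bigl
  (fun l : 'I_m => (j <= l)%N && (l != Ordinal jm))); last first.
  by move=> l; rewrite -val_eqE /=; lia.
ring.
Qed.

End Bidiagonal.

Lemma det_set_row (R : comNzRingType) n (M : 'M[R]_n) i (u : 'I_n -> R) :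
  \det (\matrix_(a, b) if a == i then u b else M a b) =
  \sum_b u b * cofactor M i b.
Proof.
case: n => [|n] in M i u *; first by case: i.
rewrite (expand_det_row _ i); apply: eq_bigr => b _; rewrite mxE eqxx.
congr (_ * (_ * \det _)); apply/matrixP => k l; rewrite !mxE.
by rewrite eq_sym (negbTE (neq_lift _ _)).
Qed.

Lemma cofactor_det (R : comNzRingType) n (M : 'M[R]_n) i j :
  cofactor M i j = \det (\matrix_(a, b) if a == i then (b == j)%:R else M a b).
Proof.
rewrite (det_set_row M i (fun b => (b == j)%:R)) (bigD1 j) //= eqxx mul1r.
by rewrite big1 ?addr0 // => b /negbTE ->; rewrite mul0r.
Qed.

(** Bordering by a row and a column with a single entry 1 changes the relevant
    cofactors by a sign only, so it embeds a problem of size [n] into one of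
    size [n.+1] having an entry of degree 0. *)
Definition border (R : nzRingType) n (i1 j1 : 'I_n.+1) (M : 'M[R]_n) :
    'M[R]_n.+1 :=
  \matrix_(i, j) match unlift i1 i, unlift j1 j with
    | Some i', Some j' => M i' j' | None, None => 1 | _, _ => 0 end.

Lemma cofactor_border (R : comNzRingType) n (i1 j1 : 'I_n.+1) (M : 'M[R]_n) i j :
  cofactor (border i1 j1 M) (lift i1 i) (lift j1 j) =
  (-1) ^+ (i1 + j1) * cofactor M i j.
Proof.
rewrite !cofactor_det (expand_det_row _ i1) (bigD1 j1) //=.
rewrite !mxE (negbTE (neq_lift _ _)) !unlift_none mul1r.
rewrite [X in _ + X]big1 ?addr0 => [|l /negbTE lj]; last first.
  rewrite !mxE (negbTE (neq_lift _ _)) unlift_none.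
  by case: unliftP lj => [l' ->|->]; rewrite ?mul0r ?eqxx.
congr (_ * \det _); apply/matrixP => k l.
by rewrite !mxE !liftK !(inj_eq lift_inj).
Qed.

Section Constructions.
Variables (r : nat) (K : numFieldType).
Local Notation S := {mpoly K[r]}.

Lemma fill_trans (I J : finType) (g : I -> S) (h : J -> S) e :
  (forall a, g a = 0 \/ exists b x, g a = x * h b) -> fill g e -> fill h e.
Proof.
move=> gh fg f /fg [u ->]; elim/big_ind: _ => [|p q [u1 ->] [u2 ->]|a _].
- by exists (fun=> 0); rewrite big1 // => b _; rewrite mul0r.
- exists (fun b => u1 b + u2 b); rewrite -big_split.
  by apply: eq_bigr => b _; rewrite mulrDl.
case: (gh a) => [->|[b [x ->]]].
  by exists (fun=> 0); rewrite mulr0 big1 // => b _; rewrite mul0r.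
exists (fun b' => if b' == b then u a * x else 0).
rewrite (bigD1 b) //= eqxx mulrA big1 ?addr0 // => b' /negbTE ->.
by rewrite mul0r.
Qed.

Lemma fill_border c n (rho : 'I_c -> 'I_n.+1 -> int)
    (gam : 'I_n.+1 -> int) (V : {set 'I_r})
    (D' : {set 'I_c * 'I_n * 'I_n}) (D : {set 'I_c * 'I_n.+1 * 'I_n.+1}) e
    (i1 j1 : 'I_n.+1) :
  (forall t, rho t i1 = gam j1) ->
  (forall t (i j : 'I_n), (t, i, j) \in D' -> (t, lift i1 i, lift j1 j) \in D) ->
  (exists2 M : 'I_c -> 'M[S]_n,
    graded (fun t i => rho t (lift i1 i)) (fun j => gam (lift j1 j)) M &
    fill (gens V D' M) e) ->
  exists2 M : 'I_c -> 'M[S]_n.+1, graded rho gam M & fill (gens V D M) e.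
Proof.
move=> rg DD' [M gM fM]; exists (fun t => border i1 j1 (M t)).
  move=> t i j; rewrite mxE.
  case: unliftP => [i' ->|->]; case: unliftP => [j' ->|->] //; try exact: is_form0.
  by rewrite rg subrr; apply: is_form1.
apply: fill_trans fM => -[[[t i] j]|v].
  rewrite /gens /=; case: ifP => [tij|_]; [right|by left].
  exists (inl (t, lift i1 i, lift j1 j)), ((-1) ^+ (i1 + j1)).
  rewrite DD' //= cofactor_border mulrA -exprD addnn -mul2n exprM sqrrN.
  by rewrite !expr1n mul1r.
by right; exists (inr v), 1; rewrite mul1r.
Qed.

Lemma mpolyX_two (x y : 'I_r) (mu : 'X_{1..r}) : x != y ->
  (forall v, v != x -> v != y -> mu v = 0%N) ->
  mdeg mu = (mu x + mu y)%N /\ 'X_[K, mu] = 'X_x ^+ mu x * 'X_y ^+ mu y.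
Proof.
move=> xy h; have yx : y != x by rewrite eq_sym.
rewrite mdegE mpolyXE_id; split; rewrite (bigD1 x) //= (bigD1 y) //=.
  by rewrite big1 ?addn0 // => v /andP[vx vy]; rewrite h.
by rewrite big1 ?mulr1 // => v /andP[vx vy]; rewrite h.
Qed.

(** Modulo the other variables, the cofactors of a bidiagonal matrix along row
    [i0] are the monomials [x ^ a_j * y ^ b_j] with [a_j] increasing and [b_j]
    decreasing.  A monomial [x ^ p * y ^ q] is divisible by none of them only if
    [p < a_(j+1)] and [q < b_j] for some [j]; the last hypothesis says
    exactly that [a_(j+1) + b_j <= e + 1], which excludes this for [p + q = e]. *)
Lemma fill_bidiagonal c m (rho : 'I_c -> 'I_m.+1 -> int)
    (gam : 'I_m.+1 -> int) (V : {set 'I_r})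
    (D : {set 'I_c * 'I_m.+1 * 'I_m.+1}) (e : int) t0 i0 (x y : 'I_r) :
  x != y -> (forall v, v != x -> v != y -> v \in V) ->
  (forall j, (t0, i0, j) \in D) ->
  (forall i j, i != i0 -> gam j <= rho t0 i) ->
  (forall i, i != i0 ->
     \sum_i rho t0 i - \sum_j gam j + rho t0 i <= e + rho t0 i0 + 1) ->
  exists2 M : 'I_c -> 'M[S]_m.+1, graded rho gam M & fill (gens V D M) e.
Proof.
move=> xy hV hD hrg he.
pose al l := `|(rho t0 (lift i0 l) - gam (widen_ord (leqnSn m) l))|%N.
pose be l := `|(rho t0 (lift i0 l) - gam (lift ord0 l))|%N.
have ni l : lift i0 l != i0 by rewrite eq_sym neq_lift.
have alE l : (al l)%:Z = rho t0 (lift i0 l) - gam (widen_ord (leqnSn m) l).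
  by rewrite gez0_abs // subr_ge0 hrg.
have beE l : (be l)%:Z = rho t0 (lift i0 l) - gam (lift ord0 l).
  by rewrite gez0_abs // subr_ge0 hrg.
pose B := bidiagonal i0 (fun l => 'X_x ^+ al l : S) (fun l => 'X_y ^+ be l).
have X_neq0 v : 'X_v != 0 :> S by rewrite -msupp_eq0 msuppX.
have hpow (v : 'I_r) k : is_form k%:Z ('X_v ^+ k : S).
  elim: k => [|k IHk]; first by rewrite expr0; apply: is_form1.
  by rewrite exprS -add1n PoszD; apply: is_formM => //; apply: is_formU.
have gB i j : is_form (rho t0 i - gam j) (B i j).
  rewrite mxE; case: unliftP => [l ->|_]; last exact: is_form0.
  case: eqP => [jl|_].
    by rewrite (_ : j = widen_ord (leqnSn m) l) -?alE //; apply: val_inj.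
  case: eqP => [jl|_]; last exact: is_form0.
  by rewrite (_ : j = lift ord0 l) -?beE //; apply: val_inj.
exists (fun t => if t == t0 then B else 0).
  by move=> t i j; case: eqP => [->|_]; [exact: gB|rewrite mxE; apply: is_form0].
pose a j := (\sum_(l < m | (l < j)%N) al l)%N.
pose b j := (\sum_(l < m | (j <= l)%N) be l)%N.
have cofE (j : 'I_m.+1) :
    cofactor B i0 j = (-1) ^+ (i0 + j) * ('X_x ^+ a j * 'X_y ^+ b j).
  rewrite bidiagonal_cofactor; last first.
    by move=> l; rewrite expf_neq0.
  by rewrite -!prodrXr.
have XY_neq0 k l : 'X_x ^+ k * 'X_y ^+ l != 0 :> S.
  by rewrite mulf_neq0 // expf_neq0.
have degE (j : 'I_m.+1) : (a j)%:Z + (b j)%:Z =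
    \sum_i rho t0 i - \sum_j gam j - (rho t0 i0 - gam j).
  have h1 := is_form_cofactor i0 j gB.
  have h2 := is_formM (hpow x (a j)) (hpow y (b j)).
  have {}h1 := is_form_sign (i0 + j) h1.
  rewrite cofE mulrA -exprD addnn -mul2n exprM sqrrN !expr1n mul1r in h1.
  have [m' hm'] : exists m', m' \in msupp ('X_x ^+ a j * 'X_y ^+ b j : S).
    case E : (msupp _) => [|m' s]; last by exists m'; rewrite mem_head.
    by have := XY_neq0 (a j) (b j); rewrite -msupp_eq0 E.
  by rewrite -(is_formP _ _ h1 _ hm') (is_formP _ _ h2 _ hm').
have aS (l : 'I_m) : a l.+1 = (a l + al l)%N.
  rewrite /a (bigD1 l) //= addnC; congr (_ + _)%N; apply: eq_bigl => l'.
  by rewrite -val_eqE /=; lia.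
have find (p q : nat) : p%:Z + q%:Z = e ->
    exists j : 'I_m.+1, (a j <= p)%N && (b j <= q)%N.
  move=> pq.
  have : forall k : 'I_m.+1, (exists j : 'I_m.+1, (a j <= p)%N && (b j <= q)%N)
      \/ (a k <= p)%N.
    case=> k; elim: k => [|k IHk] hk; first by right; rewrite /a big_pred0.
    have [//|ha] := IHk (ltnW hk); first by left.
    have [hb|hb] := leqP (b k) q.
      by left; exists (Ordinal (ltnW hk)); rewrite ha.
    have km : (k < m)%N by [].
    right; rewrite /= (aS (Ordinal km)) /=.
    have := degE (Ordinal (ltnW hk)); have := he _ (ni (Ordinal km)).
    rewrite /= in ha hb *; have := alE (Ordinal km).
    rewrite (_ : widen_ord _ _ = Ordinal (ltnW hk)); last exact: val_inj.
    lia.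
  case/(_ ord_max) => // ha; exists ord_max; rewrite ha /=.
  by rewrite /b big_pred0 // => l; rewrite leqNgt ltn_ord.
apply: fill_monomials => mu mue.
have [v /andP[vV mv]|novar] := pickP [pred v | (v \in V) && (mu v != 0%N)].
  exists (fun a => if a == inr v then 'X_[mu - U_(v)] else 0).
  rewrite (bigD1 (inr v)) //= eqxx vV big1 ?addr0; last first.
    by move=> w /negbTE ->; rewrite mul0r.
  by rewrite -mpolyXD submK //; rewrite lep1mP.
have [|md ->] := @mpolyX_two x y mu xy.
  move=> v vx vy; have := novar v; rewrite /= hV //= => /negbT.
  by rewrite negbK => /eqP.
have [|j /andP[ja jb]] := find (mu x) (mu y); first by rewrite -mue md.
exists (fun b' => if b' == inl (t0, i0, j) then
  (-1) ^+ (i0 + j) * ('X_x ^+ (mu x - a j) * 'X_y ^+ (mu y - b j)) else 0).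
rewrite (bigD1 (inl (t0, i0, j))) //= eqxx hD eqxx big1 ?addr0; last first.
  by move=> w /negbTE ->; rewrite mul0r.
rewrite cofE mulrACA -exprD addnn -mul2n exprM sqrrN !expr1n mul1r.
by rewrite mulrACA -!exprD !subnK.
Qed.

End Constructions.

(** * Removing one variable at a time *)
Section Levels.
Variables (r : nat) (K : numFieldType).
Local Notation S := {mpoly K[r]}.

Lemma sum_ltn_indicator n k : \sum_(i < n) (i < k)%:Z = (minn n k)%:Z.
Proof.
elim: n => [|n IHn]; first by rewrite big_ord0 min0n.
by rewrite big_ord_recr /= IHn; case: ltnP; lia.
Qed.

(** The cofactor of a matrix of size 1 is 1. *)
Lemma fill_size1 c (rho : 'I_c -> 'I_1 -> int) gam (V : {set 'I_r})
    (D : {set 'I_c * 'I_1 * 'I_1}) e t :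
  (t, ord0, ord0) \in D ->
  exists2 M : 'I_c -> 'M[S]_1, graded rho gam M & fill (gens V D M) e.
Proof.
move=> tD; exists (fun=> 0); first by move=> *; rewrite mxE; apply: is_form0.
move=> f _; exists (fun a => if a == inl (t, ord0, ord0) then f else 0).
rewrite (bigD1 (inl (t, ord0, ord0))) //= eqxx big1 ?addr0; last first.
  by move=> a /negbTE ->; rewrite mul0r.
by rewrite tD /cofactor det_mx00 !mulr1.
Qed.

(** Three variables, one free row.  After [k] of the [n] stages of a round, matrix
    [t] has had lowered the rows [i] with [sg t i < k], where [sg t] exchanges
    row [t] and the free row [i0]; hence stage [t] is the one at which matrix [t]
    sees its free row lowered.  A full round lowers all the degrees by one,
    which preserves the hypotheses until an entry of degree 0 shows up. *)
Lemma fill_one_row c n (rho gam : 'I_n -> int) i0 (V : {set 'I_r}) (x y z : 'I_r) :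
  (n <= c)%N -> x != y -> (forall v, v != x -> v != y -> v != z -> v \in V) ->
  (forall i j, i != i0 -> gam j <= rho i) ->
  (forall i, rho i <= rho i0 + 1) ->
  exists2 M : 'I_c -> 'M[S]_n, graded (fun=> rho) gam M &
    fill (gens V [set p : 'I_c * 'I_n * 'I_n | p.1.2 == i0] M)
         (\sum_i rho i - \sum_j gam j).
Proof.
move=> + xy hV; elim: n => [|n IHn] in rho gam i0 *; first by case: i0.
case: n => [|n] in IHn rho gam i0 * => nc hrg hri.
  apply: (@fill_size1 _ _ _ _ _ _ (Ordinal nc)).
  by rewrite inE /= (ord1 i0).
have [i1 i10] : exists i1, i1 != i0.
  by exists (lift i0 ord0); rewrite eq_sym neq_lift.
have [N] := ubnP `|(rho i1 - gam ord0)|%N.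
elim: N => // N IHN in rho hrg hri * => hN.
have [/existsP[a /existsP[b /andP[ai0 /eqP rab]]]|none] :=
  boolP [exists i, [exists j, (i != i0) && (rho i == gam j)]].
  case: (unlift_some ai0) => k i0k _.
  have := IHn (fun i => rho (lift a i)) (fun j => gam (lift b j)) k.
  case=> [|i j ik|i|M gM fM]; first exact: ltnW.
  - by apply: hrg; rewrite i0k (inj_eq lift_inj).
  - by rewrite -i0k.
  apply: (fill_border (i1 := a) (j1 := b)
     (D' := [set p : 'I_c * 'I_n.+1 * 'I_n.+1 | p.1.2 == k])); first by [].
    by move=> t i j; rewrite !inE /= i0k (inj_eq lift_inj).
  exists M => //.
  by rewrite (bigD1_ord a) // (bigD1_ord b) //= rab opprD addrACA subrr add0r.
have {}none i j : i != i0 -> gam j + 1 <= rho i.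
  move=> ii0; rewrite -ltzD1 ltrD2r lt_neqAle hrg // andbT eq_sym.
  apply: contra none => rg; apply/existsP; exists i; apply/existsP; exists j.
  by rewrite ii0.
pose D := [set p : 'I_c * 'I_n.+2 * 'I_n.+2 | p.1.2 == i0].
(* The default value [i0] gives a matrix whose number is not a row index the
   identity permutation; stage [s] relies on matrix [s] alone. *)
pose ci (t : 'I_c) : 'I_n.+2 := insubd i0 (t : nat).
pose sg t := tperm (ci t) i0.
pose rk k (t : 'I_c) i : int := rho i - (sg t i < k)%:Z.
suff: forall k, (k <= n.+2)%N -> exists2 M : 'I_c -> 'M[S]_n.+2,
    graded (rk (n.+2 - k)%N) gam M &
    fill (gens V D M) (\sum_i rho i - \sum_j gam j - (n.+2 - k)%:Z).
  move=> /(_ n.+2 (leqnn _)); rewrite subnn subr0 => -[M gM fM]; exists M => //.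
  by move=> t i j; have := gM t i j; rewrite /rk ltn0 subr0.
elim=> [|k IHk] hk.
  rewrite subn0.
  have [i j ii0|i||M gM fM] := IHN (fun i => rho i - 1).
  - by rewrite lerBrDr none.
  - by rewrite addrAC lerD2r.
  - by have := none i1 ord0 i10; lia.
  exists M; first by move=> t i j; have := gM t i j; rewrite /rk ltn_ord.
  by move: fM; rewrite sumrB sumr_const card_ord addrAC natz.
have {IHk}[M gM fM] := IHk (ltnW hk).
set k' := (n.+2 - k.+1)%N; have k'E : (n.+2 - k)%N = k'.+1 by lia.
rewrite {}k'E in gM fM.
have sk : (k' < n.+2)%N by lia.
pose s := Ordinal sk.
pose a t := sg t s.
have rkE t i : rk k' t i - (i == a t)%:Z = rk k'.+1 t i.
  have -> : (i == a t) = (sg t i == k' :> nat).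
    by rewrite /a -[k']/(val s) val_eqE -(inj_eq (@perm_inj _ (sg t))) tpermK.
  rewrite /rk -addrA -opprD; congr (_ - _).
  by rewrite ltnS; case: (ltngtP (sg t i) k').
apply: (fill_step (v := z) (a := a)).
  exists M; first by move=> t i j; rewrite rkE.
  by rewrite (_ : _ - 1 = \sum_i rho i - \sum_j gam j - k'.+1%:Z) //; lia.
pose t0 : 'I_c := widen_ord nc s.
have sgt0 : sg t0 = tperm s i0.
  by congr tperm; apply: val_inj; rewrite /ci val_insubd /= sk.
have at0 : a t0 = i0 by rewrite /a sgt0 tpermL.
apply: (@fill_bidiagonal _ _ c n.+1 (fun t i => rk k' t i - (i == a t)%:Z) gam
  (z |: V) [set p in D | p.1.2 == a p.1.1] _ t0 i0 x y xy).
- move=> v vx vy; rewrite !inE; case: eqP => //= /eqP vz; exact: hV.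
- by move=> j; rewrite !inE /= at0 eqxx.
- move=> i j ii0; rewrite rkE /rk; have := none i j ii0.
  by case: (_ < _)%N; lia.
move=> i ii0.
have -> : \sum_i (rk k' t0 i - (i == a t0)%:Z) = \sum_i rho i - k'.+1%:Z.
  rewrite (eq_bigr _ (fun i _ => rkE t0 i)) sumrB; congr (_ - _).
  rewrite (reindex_inj (@perm_inj _ (sg t0))) /=.
  rewrite (eq_bigr (fun i : 'I_n.+2 => (i < k'.+1)%:Z)); last by move=> j _; rewrite tpermK.
  by rewrite sum_ltn_indicator (minn_idPr sk).
rewrite !rkE /rk sgt0 tpermR /= ltnSn; have := hri i.
by case: (_ < _)%N; lia.
Qed.

Lemma cofactor_row_irrelevant (R : comNzRingType) n (M N : 'M[R]_n) i j :
  (forall a b, a != i -> M a b = N a b) -> cofactor M i j = cofactor N i j.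
Proof.
move=> MN; rewrite !cofactor_det; congr (\det _); apply/matrixP => a b.
by rewrite !mxE; case: eqP => // /eqP /MN.
Qed.

(** Four variables, all rows free.  The row lowered is one of largest degree,
    because [fill_one_row] requires the free row to have almost the largest
    degree. *)
Lemma fill_all_rows c n (rho gam : 'I_n -> int) (V : {set 'I_r})
    (x y z w : 'I_r) : (0 < n <= c)%N -> x != y ->
  (forall v, v != x -> v != y -> v != z -> v != w -> v \in V) ->
  (forall i j, gam j <= rho i) ->
  exists2 M : 'I_c -> 'M[S]_n, graded (fun=> rho) gam M &
    fill (gens V setT M) (\sum_i rho i - \sum_j gam j).
Proof.
move=> + xy hV; elim: n => [|n IHn] //= in rho gam *.
case: n => [|n] in IHn rho gam * => nc hrg.
  by apply: (@fill_size1 _ _ _ _ _ _ (Ordinal nc)); rewrite inE.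
have [N] := ubnP `|(\sum_i rho i - \sum_j gam j)%R|%N.
elim: N => // N IHN in rho hrg * => hN.
have [/existsP[a /existsP[b /eqP rab]]|none] :=
  boolP [exists i, [exists j, rho i == gam j]].
  have := IHn (fun i => rho (lift a i)) (fun j => gam (lift b j)).
  case=> [|i j|M gM fM]; [exact: ltnW|exact: hrg|].
  apply: (fill_border (i1 := a) (j1 := b) (D' := setT)); first by [].
    by move=> t i j; rewrite !inE.
  exists M => //.
  by rewrite (bigD1_ord a) // (bigD1_ord b) //= rab opprD addrACA subrr add0r.
have {}none i j : gam j + 1 <= rho i.
  rewrite -ltzD1 ltrD2r lt_neqAle hrg // andbT eq_sym.
  by apply: contra none => rg; apply/existsP; exists i; apply/existsP; exists j.
case: (arg_maxP rho (erefl : xpredT (ord0 : 'I_n.+2))) => i0 _ i0max.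
pose rho' i : int := rho i - (i == i0)%:Z.
have totE : \sum_i rho' i = \sum_i rho i - 1.
  rewrite sumrB; congr (_ - _); rewrite (bigD1 i0) //= eqxx big1 ?addr0 //.
  by move=> i /negbTE ->.
apply: (fill_step (v := w) (a := fun=> i0)).
  have [||M gM fM] := IHN rho'.
  - by move=> i j; rewrite /rho'; have := none i j; case: eqP => _; lia.
  - have : 0 <= \sum_i rho' i - \sum_j gam j.
      rewrite -sumrB; apply: sumr_ge0 => i _; rewrite /rho'.
      by have := none i i; case: eqP => _; lia.
    by rewrite totE; lia.
  by exists M => //; move: fM; rewrite totE addrAC.
have [v|i j _|i|M gM fM] :=
  @fill_one_row c n.+2 rho gam i0 (w |: V) x y z nc xy.
- by move=> vx vy vz; rewrite !inE; case: eqP => //= /eqP; apply: hV.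
- exact: hrg.
- by apply: le_trans (i0max i isT) _; rewrite lerDl.
(* The cofactors along row [i0] ignore row [i0], which can be made 0 to fit the
   lowered degree. *)
pose N0 t : 'M[S]_n.+2 := \matrix_(i, j) if i == i0 then 0 else M t i j.
exists N0.
  move=> t i j; rewrite mxE; case: eqP => _; first exact: is_form0.
  by rewrite subr0; apply: gM.
apply: fill_trans fM => -[[[t i] j]|v]; last first.
  by right; exists (inr v), 1; rewrite mul1r.
rewrite /gens inE /=; case: eqP => [->|_]; [right|by left].
exists (inl (t, i0, j)), 1; rewrite !inE eqxx mul1r /=.
by apply: cofactor_row_irrelevant => a b ai; rewrite mxE (negbTE ai).
Qed.

End Levels.

(** * Polynomials vanishing along curves *)
Lemma poly_eq0_horner (K : numFieldType) (q : {poly K}) :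
  (forall s, q.[s] = 0) -> q = 0.
Proof.
move=> h; apply/eqP/negP => /negP /exists_nonroot [s].
by rewrite h eqxx.
Qed.

Lemma mpoly_ring_ind n (R : nzRingType) (P : {mpoly R[n]} -> Prop) :
  (forall c, P c%:MP) -> (forall i, P 'X_i) ->
  (forall p q, P p -> P q -> P (p + q)) ->
  (forall p q, P p -> P q -> P (p * q)) -> forall p, P p.
Proof.
move=> hC hX hD hM p; rewrite [p]mpolyE.
apply: big_ind => [|//|m _]; first by rewrite -mpolyC0.
rewrite -mul_mpolyC; apply: (hM) => //; rewrite mpolyXE_id.
elim/big_ind: _ => [|p1 p2|i _]; [by rewrite -mpolyC1|exact: hM|].
elim: (m i) => [|k IHk]; first by rewrite expr0 -mpolyC1.
by rewrite exprS; apply: hM.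
Qed.

Lemma mpoly_eq0_meval (K : numFieldType) n (p : {mpoly K[n]}) :
  (forall y, p.@[y] = 0) -> p = 0.
Proof.
elim: n p => [|n IHn] p h.
  have [c cE] : exists c, p = c%:MP.
    elim/mpoly_ring_ind: (p) => [c|[]//|_ _ [a ->] [b ->]|_ _ [a ->] [b ->]].
    - by exists c.
    - by exists (a + b); rewrite mpolyCD.
    - by exists (a * b); rewrite mpolyCM.
  by have := h (fun=> 0); rewrite cE mevalC => ->.
pose val (Q : {poly {mpoly K[n]}}) := (map_poly (@mwiden n K) Q).['X_ord_max].
have [Q QE] : exists Q, p = val Q.
  elim/mpoly_ring_ind: (p) => [c|i|_ _ [a ->] [b ->]|_ _ [a ->] [b ->]].
  - by exists c%:MP%:P; rewrite /val map_polyC hornerC /= mwidenC.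
  - case: (unliftP ord_max i) => [j ->|->].
      exists ('X_j)%:P; rewrite /val map_polyC hornerC /= mwidenX mnmwiden1.
      by congr 'X_[U_(_)]; apply: val_inj; rewrite /= /bump leqNgt ltn_ord.
    by exists 'X; rewrite /val map_polyX hornerX.
  - by exists (a + b); rewrite /val rmorphD hornerD.
  - by exists (a * b); rewrite /val rmorphM hornerM.
have widenE (q : {mpoly K[n]}) y :
    (mwiden q).@[y] = q.@[fun i => y (widen_ord (leqnSn n) i)].
  elim/mpoly_ring_ind: q => [c|i|a b ha hb|a b ha hb].
  - by rewrite mwidenC !mevalC.
  - by rewrite mwidenX mnmwiden1 !mevalXU.
  - by rewrite mwidenD !mevalD ha hb.
  - by rewrite mwidenM !mevalM ha hb.
suff Q0 : Q = 0 by rewrite QE /val Q0 rmorph0 horner0.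
apply/polyP => k; rewrite coef0; apply: IHn => y.
suff : map_poly (meval y) Q = 0.
  by move=> /(congr1 (fun q : {poly K} => q`_k)); rewrite coef_map coef0.
apply: poly_eq0_horner => s.
pose ys (i : 'I_n.+1) := if unlift ord_max i is Some j then y j else s.
rewrite -(h ys) QE /val -[RHS]/(meval ys _) -horner_map -map_poly_comp /=.
rewrite mevalXU {2}/ys unlift_none; congr (_.[s]); apply: eq_map_poly => q /=.
rewrite widenE; apply: meval_eq => i; rewrite /ys.
have -> : widen_ord (leqnSn n) i = lift ord_max i.
  by apply: val_inj; rewrite /= /bump leqNgt ltn_ord.
by rewrite liftK.
Qed.

(** The lowest homogeneous part [h] of [P] at [w] governs the behaviour of [P]
    along a curve [w + s * y + ...]: dividing by the power of [s] that is its
    order and letting [s = 0] leaves [h] at [y].  So [h] vanishes everywhere. *)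
Lemma mpoly_eq0_of_curves (K : numFieldType) n (P : {mpoly K[n]}) (w : 'I_n -> K) :
  (forall y, exists2 Y : 'I_n -> {poly K}, (forall i, (Y i).[0] = y i) &
    forall s, P.@[fun i => w i + s * (Y i).[s]] = 0) -> P = 0.
Proof.
move=> hP.
pose P' := P \mPo [tuple 'X_i + (w i)%:MP | i < n].
have P'E z : P'.@[z] = P.@[fun i => w i + z i].
  rewrite comp_mpoly_meval; apply: meval_eq => i.
  by rewrite tnth_mktuple mevalD mevalXU mevalC addrC.
have [P'0|P'0] := eqVneq P' 0.
  apply: mpoly_eq0_meval => y.
  have := P'E (fun i => y i - w i); rewrite P'0 meval0 => h.
  by rewrite [RHS]h; apply: meval_eq => i; rewrite addrC subrK.
have [m0 m0P m0min] : exists2 m0, m0 \in msupp P' &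
    forall m, m \in msupp P' -> (mdeg m0 <= mdeg m)%N.
  have [m1 m1P] : exists m, m \in msupp P'.
    case E : (msupp P') => [|m s]; last by exists m; rewrite mem_head.
    by move: P'0; rewrite -msupp_eq0 E.
  have ex : exists k, has (fun m => mdeg m == k) (msupp P').
    by exists (mdeg m1); apply/hasP; exists m1.
  case: (ex_minnP ex) => k /hasP[m mP /eqP mk] kmin.
  exists m => // m' m'P; rewrite mk; apply: kmin.
  by apply/hasP; exists m'.
pose mu := mdeg m0.
pose h := form_part mu P'.
have h0 : h = 0.
  apply: mpoly_eq0_meval => y; have [Y Y0 YP] := hP y.
  pose T := \sum_(m <- msupp P')
     P'@_m *: ('X ^+ (mdeg m - mu) * \prod_i Y i ^+ m i).
  have TE s : s ^+ mu * T.[s] = 0.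
    rewrite -(YP s) -P'E mevalE horner_sum mulr_sumr big_seq [RHS]big_seq.
    apply: eq_bigr => m mP; rewrite hornerZ mulrCA; congr (_ * _).
    rewrite hornerM hornerXn mulrA -exprD subnKC ?m0min // horner_prod mdegE.
    rewrite expr_sum -big_split /=; apply: eq_bigr => i _.
    by rewrite horner_exp exprMn.
  have T0 : 'X ^+ mu * T = 0.
    by apply: poly_eq0_horner => s; rewrite hornerM hornerXn.
  move/eqP: T0; rewrite mulf_eq0 expf_eq0 polyX_eq0 andbF /= => /eqP T0.
  have := congr1 (fun q : {poly K} => q.[0]) T0.
  rewrite horner0 => <-; rewrite /h /form_part raddf_sum horner_sum.
  rewrite [RHS](bigID (fun m => (mdeg m)%:Z == mu)) /=.
  rewrite [X in _ = _ + X]big_seq_cond.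
  rewrite [X in _ = _ + X]big1 => [|m /andP[mP mm]]; last first.
    rewrite hornerZ hornerM hornerXn expr0n subn_eq0.
    by rewrite leqNgt ltn_neqAle eq_sym mm m0min // mul0r mulr0.
  rewrite addr0; apply: eq_bigr => m /eqP [->]; rewrite mevalZ mevalX hornerZ.
  rewrite subnn expr0 mul1r horner_prod; congr (_ * _).
  by apply: eq_bigr => i _; rewrite horner_exp Y0.
have := @form_part_off_degree _ _ mu P' m0; rewrite -/h h0 subr0 => /(_ m0P).
by rewrite eqxx.
Qed.

(** * Images of polynomial maps *)
Section Generic.
Variables (K : numClosedFieldType) (n : nat).

Definition env (y : 'I_n -> K) : seq K := codom y.

Lemma nth_env y i : (env y)`_i = if insub i is Some j then y j else 0.
Proof.
rewrite /env codomE; case: insubP => [j _ <-|ni].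
  by rewrite /= (nth_map j) ?size_enum_ord ?nth_ord_enum ?ltn_ord.
by rewrite nth_default // size_map size_enum_ord leqNgt.
Qed.

Lemma term_mpoly (t : GRing.term K) : GRing.rterm t ->
  exists p : {mpoly K[n]}, forall y, GRing.eval (env y) t = p.@[y].
Proof.
elim: t => //= [i _|a _|k _|t IHt u IHu|t IHt|t IHt k|t IHt u IHu|t IHt k].
- exists (if insub i is Some j then 'X_j else 0) => y; rewrite nth_env.
  by case: insubP => [j _ _|_]; rewrite ?mevalXU ?meval0.
- by exists a%:MP => y; rewrite mevalC.
- by exists k%:R => y; rewrite rmorph_nat.
- by case/andP=> /IHt[p hp] /IHu[q hq]; exists (p + q) => y; rewrite mevalD hp hq.
- by case/IHt=> p hp; exists (- p) => y; rewrite mevalN hp.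
- by case/IHt=> p hp; exists (p *+ k) => y; rewrite mevalMn hp.
- by case/andP=> /IHt[p hp] /IHu[q hq]; exists (p * q) => y; rewrite mevalM hp hq.
- by case/IHt=> p hp; exists (p ^+ k) => y; rewrite rmorphXn /= hp.
Qed.

(** A polynomial equation is either an identity or false on a principal open
    set, and truth values that are constant on two nonempty principal open sets
    are constant on the intersection of these sets. *)
Lemma generic_dichotomy (f : GRing.formula K) :
  GRing.qf_form f -> GRing.rformula f ->
  exists2 P : {mpoly K[n]}, P != 0 &
    (forall y, P.@[y] != 0 -> GRing.holds (env y) f) \/
    (forall y, P.@[y] != 0 -> ~ GRing.holds (env y) f).
Proof.
have P1 : 1 != 0 :> {mpoly K[n]} by apply: oner_neq0.
pose good f (P : {mpoly K[n]}) := P != 0 /\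
    ((forall y, P.@[y] != 0 -> GRing.holds (env y) f) \/
    (forall y, P.@[y] != 0 -> ~ GRing.holds (env y) f)).
suff: GRing.qf_form f -> GRing.rformula f -> exists P, good f P.
  by move=> h qf rf; have [P [P0 hP]] := h qf rf; exists P.
have two f1 f2 f3 : (exists P, good f1 P) -> (exists P, good f2 P) ->
    (forall P : {mpoly K[n]}, P != 0 -> good f1 P -> good f2 P -> good f3 P) ->
    exists P, good f3 P.
  have weak g P Q : Q != 0 -> (forall y, Q.@[y] != 0 -> P.@[y] != 0) ->
      good g P -> good g Q.
    by move=> Q0 h [_ [hg|hg]]; split=> //; [left|right] => y /h; apply: hg.
  move=> [P hP] [Q hQ] h; exists (P * Q).
  have PQ0 : P * Q != 0 by rewrite mulf_neq0 // ?hP.1 ?hQ.1.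
  have PQy y : (P * Q).@[y] != 0 -> P.@[y] != 0 /\ Q.@[y] != 0.
    by rewrite mevalM mulf_eq0 negb_or => /andP.
  by apply: h => //; [apply: weak hP|apply: weak hQ] => // y /PQy [].
elim: f => //= [b _ _|t u _ /andP[rt ru]|f1 IH1 f2 IH2|f1 IH1 f2 IH2|
    f1 IH1 f2 IH2|f1 IH1].
- by exists 1; split=> //; case: b; [left|right].
- have [p hp] := term_mpoly rt; have [q hq] := term_mpoly ru.
  have [pq|pq] := eqVneq p q.
    by exists 1; split=> //; left=> y _; rewrite /= hp hq pq.
  exists (p - q); split; first by rewrite subr_eq0.
  by right=> y; rewrite mevalB subr_eq0 /= hp hq => /eqP.
- move=> /andP[q1 q2] /andP[r1 r2]; apply: two (IH1 q1 r1) (IH2 q2 r2) _.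
  move=> P P0 [_ h1] [_ h2]; split=> //.
  case: h1 => h1; last by right=> y Py [] /(h1 _ Py).
  case: h2 => h2; last by right=> y Py [_] /(h2 _ Py).
  by left=> y Py; split; [apply: h1|apply: h2].
- move=> /andP[q1 q2] /andP[r1 r2]; apply: two (IH1 q1 r1) (IH2 q2 r2) _.
  move=> P P0 [_ h1] [_ h2]; split=> //.
  case: h1 => h1; first by left=> y Py; left; apply: h1.
  case: h2 => h2; first by left=> y Py; right; apply: h2.
  by right=> y Py [] => [/(h1 _ Py)|/(h2 _ Py)].
- move=> /andP[q1 q2] /andP[r1 r2]; apply: two (IH1 q1 r1) (IH2 q2 r2) _.
  move=> P P0 [_ h1] [_ h2]; split=> //.
  case: h1 => h1; last by left=> y Py /(h1 _ Py).
  case: h2 => h2; first by left=> y Py _; apply: h2.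
  by right=> y Py h; apply: (h2 _ Py); apply: h; apply: h1.
- move=> q1 r1; have [P [P0 [h1|h1]]] := IH1 q1 r1.
    by exists P; split=> //; right=> y Py /=; apply; apply: h1.
  by exists P; split=> //; left=> y Py /=; apply: h1.
Qed.

(** Membership in the image is a first-order formula with [l] existential
    quantifiers; variables [0 .. n-1] of the formula are the coordinates of the
    target and [n .. n+l-1] those of the source. *)
Lemma image_dichotomy l (phi : 'I_n -> {mpoly K[l]}) :
  exists2 P : {mpoly K[n]}, P != 0 &
    (forall y, P.@[y] != 0 -> exists x, forall i, y i = (phi i).@[x]) \/
    (forall x, P.@[fun i => (phi i).@[x]] = 0).
Proof.
have tm (p : {mpoly K[l]}) : exists t : GRing.term K, GRing.rterm t /\
    forall e, GRing.eval e t = p.@[fun i => e`_(n + i)].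
  elim/mpoly_ring_ind: p => [a|i|p q [t [rt tE]] [u [ru uE]]|
      p q [t [rt tE]] [u [ru uE]]].
  - by exists (GRing.Const a); split=> // e; rewrite mevalC.
  - by exists (GRing.Var K (n + i)); split=> // e; rewrite mevalXU.
  - by exists (GRing.Add t u); rewrite /= rt ru; split=> // e; rewrite mevalD tE uE.
  - by exists (GRing.Mul t u); rewrite /= rt ru; split=> // e; rewrite mevalM tE uE.
have [t ht] := fin_all_exists (fun i => tm (phi i)).
pose body := foldr GRing.And (GRing.Bool true)
  [seq GRing.Equal (GRing.Var K (i : 'I_n)) (t i) | i <- enum 'I_n].
have bodyP e : GRing.holds e body <->
    forall i : 'I_n, e`_i = (phi i).@[fun j => e`_(n + j)].
  have : GRing.holds e body <->
      {in enum 'I_n, forall i : 'I_n, e`_i = (phi i).@[fun j => e`_(n + j)]}.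
    rewrite /body; elim: (enum _) => [|i s IHs] //=; rewrite (ht i).2 IHs.
    split=> [[h1 h2] j|h]; first by rewrite inE => /orP[/eqP->|/h2].
    by split=> [|j js]; apply: h; rewrite inE ?eqxx ?js ?orbT.
  by move=> ->; split=> h i => [|_]; apply: h; rewrite mem_enum.
have rbody : GRing.rformula body.
  by rewrite /body; elim: (enum _) => //= i s ->; rewrite (ht i).1.
pose f := foldr GRing.Exists body (iota n l).
have rf : GRing.rformula f.
  by rewrite /f; elim: (iota _ _).
have fP y : GRing.holds (env y) f <-> exists x, forall i, y i = (phi i).@[x].
  rewrite -GRing.foldExistsP; split=> [[e eE /bodyP he]|[x hx]].
    exists (fun j : 'I_l => e`_(n + j)) => i; rewrite -he -eE; last first.
      by rewrite !inE mem_iota leqNgt ltn_ord.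
    by rewrite nth_env valK.
  exists (env y ++ codom x).
    move=> i; rewrite !inE mem_iota nth_cat size_codom card_ord.
    have [//|ni] := ltnP i n; rewrite /= -leqNgt => il.
    by rewrite !nth_default // size_codom card_ord // leq_subRL.
  apply/bodyP => i; rewrite nth_cat size_codom card_ord ltn_ord nth_env valK hx.
  apply: meval_eq => j; rewrite nth_cat size_codom card_ord ltnNge leq_addr /=.
  by rewrite addKn codomE (nth_map j) ?size_enum_ord ?nth_ord_enum.
pose q := GRing.quantifier_elim (@ClosedFieldQE.ex_elim K) f.
have wf := @ClosedFieldQE.wf_ex_elim K.
have ok := @ClosedFieldQE.holds_ex_elim K (@solve_monicpoly K).
have /andP[qq qr] := GRing.quantifier_elim_wf wf rf.
have qP y : GRing.holds (env y) q <-> GRing.holds (env y) f.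
  have := GRing.quantifier_elim_rformP wf ok (env y) rf.
  have := GRing.qf_evalP (env y) qq.
  by move=> h1 h2; split=> [/h1/h2|/h2/h1].
have [P P0 [hP|hP]] := generic_dichotomy qq qr; exists P => //.
  by left=> y /hP /qP /fP.
right=> x; apply/eqP/negP => /negP /hP; apply; apply/qP/fP.
by exists x.
Qed.

Lemma image_generic l (phi : 'I_n -> {mpoly K[l]}) (x0 : 'I_l -> K) :
  (forall y, exists u, exists2 Y : 'I_n -> {poly K}, (forall i, (Y i).[0] = y i) &
    forall s i, (phi i).@[fun j => x0 j + s * u j] =
                (phi i).@[x0] + s * (Y i).[s]) ->
  exists2 P : {mpoly K[n]}, P != 0 &
    forall y, P.@[y] != 0 -> exists x, forall i, y i = (phi i).@[x].
Proof.
move=> h; have [P P0 [hP|hP]] := image_dichotomy phi; first by exists P.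
case/eqP: P0; apply: (mpoly_eq0_of_curves (w := fun i => (phi i).@[x0])) => y.
have [u [Y Y0 YE]] := h y; exists Y => // s.
rewrite -(hP (fun j => x0 j + s * u j)); apply: meval_eq => i.
by rewrite YE.
Qed.

End Generic.

(** * First-order expansion of determinants *)
Lemma deriv_prod (R : comNzRingType) (I : finType) (f : I -> {poly R}) :
  (\prod_i f i)^`() = \sum_i (f i)^`() * \prod_(j | j != i) f j.
Proof.
suff H (r : seq I) : uniq r -> (\prod_(i <- r) f i)^`() =
    \sum_(i <- r) (f i)^`() * \prod_(j <- r | j != i) f j.
  exact: H (index_enum_uniq I).
elim: r => [|a r IHr] /=; first by rewrite !big_nil derivC.
case/andP=> ar /IHr {}IHr; rewrite !big_cons derivM eqxx /= IHr.
congr (_ * _ + _).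
  rewrite big_seq [RHS]big_seq_cond; apply: eq_bigl => j.
  by case: (boolP (j \in r)) => //= jr; apply/esym/(contraNneq _ ar) => <-.
rewrite mulr_sumr big_seq [RHS]big_seq; apply: eq_bigr => i ir.
rewrite big_cons ifT; last by apply: contraNneq ar => ->.
by rewrite mulrCA.
Qed.

Lemma deriv_det (R : comNzRingType) n (P : 'M[{poly R}]_n) :
  (\det P)^`() = \sum_i \sum_j (P i j)^`() * cofactor P i j.
Proof.
under eq_bigr => i _ do rewrite -(det_set_row P i (fun j => (P i j)^`())).
rewrite exchange_big /= raddf_sum; apply: eq_bigr => s _ /=.
rewrite -mulr_sumr -signr_odd !mulr_sign [in LHS](fun_if (@deriv R)) derivN.
rewrite deriv_prod; congr (if _ then - _ else _); apply: eq_bigr => i _;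
 rewrite [RHS](bigD1 i) //= mxE eqxx; congr (_ * _); apply: eq_bigr => j ji;
 by rewrite mxE (negbTE ji).
Qed.

Lemma det_second_order (R : comNzRingType) n (M U : 'M[R]_n) :
  exists Z : {poly R}, forall s, \det (M + s *: U) =
    \det M + s * (\sum_i \sum_j U i j * cofactor M i j) + s ^+ 2 * Z.[s].
Proof.
pose P := map_mx polyC M + 'X *: map_mx polyC U.
have PE s i j : (P i j).[s] = (M + s *: U) i j.
  by rewrite !mxE hornerD hornerC mulrC hornerCM hornerX mulrC.
have DE s : (\det P).[s] = \det (M + s *: U).
  rewrite -/(horner_eval s _) -det_map_mx; congr (\det _).
  by apply/matrixP => i j; rewrite mxE -PE.
have P0 : \matrix_(i, j) (P i j).[0] = M.
  by apply/matrixP => i j; rewrite mxE PE scale0r addr0.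
have D0 : (\det P)`_0 = \det M by rewrite -horner_coef0 DE scale0r addr0.
have D1 : (\det P)`_1 = \sum_i \sum_j U i j * cofactor M i j.
  have -> : (\det P)`_1 = ((\det P)^`()).[0].
    by rewrite horner_coef0 coef_deriv mulr1n.
  rewrite deriv_det horner_sum; apply: eq_bigr => i _.
  rewrite horner_sum; apply: eq_bigr => j _.
  rewrite hornerM horner_cofactor P0; congr (_ * _).
  by rewrite !mxE derivD derivC add0r derivM derivX derivC mulr0 addr0 mul1r hornerC.
exists (drop_poly 2 (\det P)) => s.
rewrite -DE -{1}(poly_take_drop 2 (\det P)) hornerD hornerM hornerXn.
congr (_ + _); last exact: mulrC.
rewrite (@horner_coef_wide _ 2) ?size_take_poly //.
by rewrite !big_ord_recl big_ord0 !coef_take_poly /= D0 D1; ring.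
Qed.

(** * Pfaffians of off-diagonal blocks *)
Section Blocks.
Variable k : nat.

Lemma mul2n_add : (2 * k = k + k)%N. Proof. by rewrite mul2n addnn. Qed.

Definition lo_idx (i : 'I_k) : 'I_(2 * k) := cast_ord (esym mul2n_add) (lshift k i).
Definition hi_idx (i : 'I_k) : 'I_(2 * k) := cast_ord (esym mul2n_add) (rshift k i).

Lemma lo_hiP (a : 'I_(2 * k)) : exists i, a = lo_idx i \/ a = hi_idx i.
Proof.
case: (split_ordP (cast_ord mul2n_add a)) => i E; exists i; [left|right];
  by rewrite /lo_idx /hi_idx -E cast_ordK.
Qed.

Lemma half_idx_subproof (a : 'I_(2 * k)) : (a./2 < k)%N.
Proof. by rewrite ltn_half_double -mul2n. Qed.

Lemma fst_sndP (a : 'I_(2 * k)) : exists t, a = fst_idx t \/ a = snd_idx t.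
Proof.
exists (Ordinal (half_idx_subproof a)).
case E : (odd a); [right|left]; apply: val_inj => /=;
  by rewrite -[LHS]odd_double_half E -mul2n.
Qed.

Lemma lo_idx_inj : injective lo_idx.
Proof. by move=> i j /(congr1 val) /= /val_inj. Qed.

Lemma hi_idx_inj : injective hi_idx.
Proof. by move=> i j /(congr1 val) /= /addnI /val_inj. Qed.

Lemma lo_lt_hi i j : (lo_idx i < hi_idx j)%N.
Proof. by rewrite /= ltn_addr. Qed.

Lemma lo_hi_neq i j : (lo_idx i == hi_idx j) = false.
Proof. by apply/eqP => /(congr1 val) /= h; have := ltn_ord i; rewrite h ltnNge leq_addr. Qed.

Definition skew_block (R : nzRingType) (B : 'M[R]_k) : 'M[R]_(2 * k) :=
  castmx (esym mul2n_add, esym mul2n_add) (block_mx 0 B (- B^T) 0).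

Section Entries.
Variables (R : nzRingType) (B : 'M[R]_k).

Lemma skew_block_lo_lo i j : skew_block B (lo_idx i) (lo_idx j) = 0.
Proof. by rewrite castmxE /= !esymK !cast_ordKV block_mxEul mxE. Qed.

Lemma skew_block_lo_hi i j : skew_block B (lo_idx i) (hi_idx j) = B i j.
Proof. by rewrite castmxE /= !esymK !cast_ordKV block_mxEur. Qed.

Lemma skew_block_hi_lo i j : skew_block B (hi_idx i) (lo_idx j) = - B j i.
Proof. by rewrite castmxE /= !esymK !cast_ordKV block_mxEdl !mxE. Qed.

Lemma skew_block_hi_hi i j : skew_block B (hi_idx i) (hi_idx j) = 0.
Proof. by rewrite castmxE /= !esymK !cast_ordKV block_mxEdr mxE. Qed.

Lemma skew_block_skew : skew_symmetric (skew_block B).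
Proof.
apply/matrixP => a b; rewrite !mxE.
have [i [->|->]] := lo_hiP a; have [j [->|->]] := lo_hiP b.
- by rewrite !skew_block_lo_lo oppr0.
- by rewrite skew_block_lo_hi skew_block_hi_lo.
- by rewrite skew_block_lo_hi skew_block_hi_lo opprK.
- by rewrite !skew_block_hi_hi oppr0.
Qed.

End Entries.

(** [shuffle] is the matching of [lo_idx t] with [hi_idx t] for all [t]; its sign is
    the sign between pfaffian and determinant. *)
Definition shuffle_fun (a : 'I_(2 * k)) : 'I_(2 * k) :=
  (if odd a then @hi_idx else @lo_idx) (Ordinal (half_idx_subproof a)).

Lemma shuffle_fst t : shuffle_fun (fst_idx t) = lo_idx t.
Proof.
have ot : odd (fst_idx t) = false by rewrite [val _]/= mul2n odd_double.
rewrite /shuffle_fun ot; congr lo_idx; apply: val_inj.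
by rewrite /= mul2n doubleK.
Qed.

Lemma shuffle_snd t : shuffle_fun (snd_idx t) = hi_idx t.
Proof.
have ot : odd (snd_idx t) by rewrite /= mul2n odd_double.
rewrite /shuffle_fun ot; congr hi_idx; apply: val_inj.
by rewrite /= mul2n uphalf_double.
Qed.

Lemma shuffle_inj : injective shuffle_fun.
Proof.
move=> a b; have [i [->|->]] := fst_sndP a; have [j [->|->]] := fst_sndP b;
  rewrite ?shuffle_fst ?shuffle_snd.
- by move/lo_idx_inj ->.
- by move/eqP; rewrite lo_hi_neq.
- by move/eqP; rewrite eq_sym lo_hi_neq.
- by move/hi_idx_inj ->.
Qed.

Definition shuffle : 'S_(2 * k) := perm shuffle_inj.

Definition on_hi_fun (s : 'S_k) (a : 'I_(2 * k)) : 'I_(2 * k) :=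
  match split (cast_ord mul2n_add a) with
  | inl i => lo_idx i | inr j => hi_idx (s j) end.

Lemma on_hi_lo s i : on_hi_fun s (lo_idx i) = lo_idx i.
Proof. by rewrite /on_hi_fun cast_ordKV -/(unsplit (inl i)) unsplitK. Qed.

Lemma on_hi_hi s i : on_hi_fun s (hi_idx i) = hi_idx (s i).
Proof. by rewrite /on_hi_fun cast_ordKV -/(unsplit (inr i)) unsplitK. Qed.

Lemma on_hi_inj s : injective (on_hi_fun s).
Proof.
move=> a b; have [i [->|->]] := lo_hiP a; have [j [->|->]] := lo_hiP b;
  rewrite ?on_hi_lo ?on_hi_hi //.
- by move/eqP; rewrite lo_hi_neq.
- by move/eqP; rewrite eq_sym lo_hi_neq.
- by move/hi_idx_inj/perm_inj ->.
Qed.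

Definition on_hi s : 'S_(2 * k) := perm (@on_hi_inj s).

Lemma on_hiM s u : on_hi (s * u)%g = (on_hi s * on_hi u)%g.
Proof.
apply/permP => a; rewrite permM !permE.
by have [i [->|->]] := lo_hiP a; rewrite ?on_hi_lo ?on_hi_hi ?permM.
Qed.

Lemma on_hi_tperm i j : on_hi (tperm i j) = tperm (hi_idx i) (hi_idx j).
Proof.
apply/permP => a; rewrite permE; have [l [->|->]] := lo_hiP a.
  by rewrite on_hi_lo tpermD // eq_sym lo_hi_neq.
rewrite on_hi_hi; case: tpermP => [->|->|/eqP li /eqP lj].
- by rewrite tpermL.
- by rewrite tpermR.
- by rewrite tpermD // (inj_eq hi_idx_inj) eq_sym.
Qed.

(** [on_hi] is a morphism sending transpositions to transpositions. *)
Lemma odd_on_hi s : odd_perm (on_hi s) = odd_perm s.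
Proof.
have [ts -> _] := prod_tpermP s; elim: ts => [|[i j] ts IHts].
  rewrite !big_nil odd_perm1; have -> : on_hi 1 = 1%g; last exact: odd_perm1.
  apply/permP => a; rewrite permE perm1.
  by have [i [->|->]] := lo_hiP a; rewrite ?on_hi_lo ?on_hi_hi ?perm1.
rewrite !big_cons /= on_hiM on_hi_tperm !odd_permM IHts !odd_tperm.
by rewrite (inj_eq hi_idx_inj).
Qed.

Definition bipartite_matching (s : 'S_k) : 'S_(2 * k) := (shuffle * on_hi s)%g.

Lemma bipartite_fst s t : bipartite_matching s (fst_idx t) = lo_idx t.
Proof. by rewrite permM !permE shuffle_fst on_hi_lo. Qed.

Lemma bipartite_snd s t : bipartite_matching s (snd_idx t) = hi_idx (s t).
Proof. by rewrite permM !permE shuffle_snd on_hi_hi. Qed.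

Lemma bipartite_inj : injective bipartite_matching.
Proof.
move=> s u su; apply/permP => t; apply: hi_idx_inj.
by rewrite -!bipartite_snd su.
Qed.

Lemma bipartite_perfect s : perfect_matching (bipartite_matching s).
Proof.
apply/andP; split; apply/forallP => t.
  by rewrite bipartite_fst bipartite_snd lo_lt_hi.
by apply/forallP => u; apply/implyP; rewrite !bipartite_fst.
Qed.

Lemma increasing_id (f : 'I_k -> 'I_k) :
  (forall t u : 'I_k, (t < u)%N -> (f t < f u)%N) -> f =1 id.
Proof.
move=> incf.
have step m (t u : 'I_k) : (t + m = u :> nat)%N -> (f t + m <= f u)%N.
  elim: m u => [|m IHm] u tu.
    by rewrite addn0 (_ : t = u) //; apply: val_inj; rewrite /= -tu addn0.
  have mk : (t + m < k)%N by have := ltn_ord u; lia.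
  have := IHm (Ordinal mk) erefl; have := incf (Ordinal mk) u.
  by rewrite /=; lia.
move=> t; apply: val_inj => /=; have kt := ltn_ord t.
have k0 : (0 < k)%N by lia.
have k1 : (k.-1 < k)%N by lia.
have := step (t : nat) (Ordinal k0) t erefl.
have := step (k.-1 - t)%N t (Ordinal k1).
by have := ltn_ord (f (Ordinal k1)); rewrite /=; lia.
Qed.

(** The first elements of the pairs increase with [t] and take [k] values among
    the [k] low indices, so the [t]-th one is [lo_idx t]: the matching is
    determined by the permutation given by the second elements. *)
Lemma perfect_bipartite (s : 'S_(2 * k)) : perfect_matching s ->
  (forall t, exists i j, s (fst_idx t) = lo_idx i /\ s (snd_idx t) = hi_idx j) ->
  exists u, s = bipartite_matching u.
Proof.
case/andP=> _ /forallP incs h.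
have [f hf] := fin_all_exists h; have [g hg] := fin_all_exists hf.
have fid : f =1 id.
  apply: increasing_id => t u tu.
  by have /forallP/(_ u)/implyP/(_ tu) := incs t; rewrite (hg t).1 (hg u).1.
have ginj : injective g.
  move=> t u gtu; have /perm_inj : s (snd_idx t) = s (snd_idx u).
    by rewrite (hg t).2 (hg u).2 gtu.
  by move=> /(congr1 val) /= [] /eqP; rewrite eqn_pmul2l // => /eqP /val_inj.
exists (perm ginj); apply/permP => a; have [t [->|->]] := fst_sndP a.
  by rewrite bipartite_fst (hg t).1 fid.
by rewrite bipartite_snd (hg t).2 permE.
Qed.

(** A matching contributes only if each pair joins a low index to a high one, and
    such matchings correspond to the permutations in the expansion of [\det B]. *)
Lemma pfaffian_skew_block (R : comNzRingType) (B : 'M[R]_k) :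
  pfaffian (skew_block B) = (-1) ^+ shuffle * \det B.
Proof.
rewrite /pfaffian (bigID (mem (bipartite_matching @: setT))) /=.
rewrite [X in _ + X]big1 ?addr0 => [|s /andP[ms ns]]; last first.
  have [|/forallPn[t]] := boolP [forall t, (s (fst_idx t) < k <= s (snd_idx t))%N].
    move=> /forallP h; case/imsetP: ns.
    have [t|u ->] := perfect_bipartite ms; last by exists u; rewrite ?inE.
    have /andP[h1 h2] := h t; have [i iE] := lo_hiP (s (fst_idx t)).
    have [j jE] := lo_hiP (s (snd_idx t)); exists i, j; split.
      by case: iE h1 => -> //=; rewrite ltnNge leq_addr.
    by case: jE h2 => -> //=; rewrite leqNgt ltn_ord.
  move=> h; rewrite (bigD1 t) //=.
  have lt : (s (fst_idx t) < s (snd_idx t))%N by case/andP: ms => /forallP.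
  suff -> : skew_block B (s (fst_idx t)) (s (snd_idx t)) = 0.
    by rewrite mul0r mulr0.
  have [i iE] := lo_hiP (s (fst_idx t)); have [j jE] := lo_hiP (s (snd_idx t)).
  case: iE jE h lt => -> [] ->; rewrite ?skew_block_lo_lo ?skew_block_hi_hi //.
    by rewrite /= ltn_ord leq_addr.
  by move=> _; rewrite ltnNge ltnW // lo_lt_hi.
rewrite (eq_bigl (mem (bipartite_matching @: setT))); last first.
  move=> s /=; rewrite andbC; case: imsetP => //= -[u _ ->].
  by rewrite bipartite_perfect.
rewrite big_imset /=; last by move=> s u _ _; apply: bipartite_inj.
rewrite mulr_sumr; apply: eq_big => [s|s _]; first by rewrite inE.
rewrite mulrA -signr_addb /bipartite_matching odd_permM odd_on_hi.
congr (_ * _); apply: eq_bigr => t _.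
by rewrite -/(bipartite_matching s) bipartite_fst bipartite_snd skew_block_lo_hi.
Qed.

End Blocks.

(** * General forms as sums of determinants *)
Lemma general_image (K : numClosedFieldType) (V : vectType K) l
    (G : ('I_l -> K) -> V)
    (phi : 'I_(\dim (fullv : {vspace V})) -> {mpoly K[l]}) (x0 : 'I_l -> K) :
  (forall x i, vcoords (G x) i = (phi i).@[x]) ->
  (forall v, exists u,
     exists2 Y : 'I_(\dim (fullv : {vspace V})) -> {poly K},
       (forall i, (Y i).[0] = vcoords v i) &
     forall s i, vcoords (G (fun j => x0 j + s * u j)) i =
                 vcoords (G x0) i + s * (Y i).[s]) ->
  holds_for_general (fun v => exists x, v = G x).
Proof.
move=> hphi hcurve.
have vcoordsK y : exists v : V, vcoords v =1 y.
  exists (\sum_i y i *: (vbasis fullv)`_i) => i.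
  by rewrite /vcoords coord_sum_free // (basis_free (vbasisP _)).
have vcoords_inj (v w : V) : vcoords v =1 vcoords w -> v = w.
  move=> vw; rewrite (coord_vbasis (memvf v)) (coord_vbasis (memvf w)).
  by apply: eq_bigr => i _; rewrite -/(vcoords v i) vw.
have [|P P0 hP] := @image_generic K _ l phi x0.
  move=> y; have [v vE] := vcoordsK y; have [u [Y Y0 YE]] := hcurve v.
  exists u, Y; first by move=> i; rewrite Y0 vE.
  by move=> s i; rewrite -!hphi YE.
exists (fun v => P.@[vcoords v] != 0); split.
- exists (eq P) => v; split=> [Pv|[_ <-] //]; by exists P.
- apply: contrapT => /forallNP none; case/eqP: P0.
  apply: mpoly_eq0_meval => y; have [v vE] := vcoordsK y.
  by have /negP := none v; rewrite negbK (meval_eq _ vE) => /eqP.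
- move=> v /hP[x xE]; exists x; apply: vcoords_inj => i.
  by rewrite xE hphi.
Qed.

Lemma dhomog_msize_le n (R : nzRingType) d (p : {mpoly R[n]}) :
  p \is d.-homog -> (msize p <= d.+1)%N.
Proof.
move=> /dhomogP hp; rewrite msizeE; apply/bigmax_leqP_seq => m mp _.
by rewrite ltnS (hp m mp).
Qed.

Section FormCoords.
Variables (K : fieldType) (r d : nat).
Local Notation V := (dhomog r.+1 K d).
Local Notation N := (\dim (fullv : {vspace V})).

(** Coordinates in the chosen basis of the space of forms are linear in the
    coefficients; [coord_form] extends them to all polynomials, for use on terms
    that are not known to be forms. *)
Definition form_coord (i : 'I_N) (m : 'X_{1..r.+1}) : K :=
  vcoords (@indhomog _ _ d 'X_[m] : V) i.

Definition coord_form (i : 'I_N) (p : {mpoly K[r.+1]}) : K :=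
  \sum_(m : 'X_{1..r.+1 < d.+1}) p@_m * form_coord i m.

Lemma coord_formE (v : V) i : vcoords v i = coord_form i v.
Proof.
have {1}-> : v = \sum_(m : 'X_{1..r.+1 < d.+1}) v@_m *: @indhomog _ _ d 'X_[m].
  apply: val_inj => /=; rewrite raddf_sum /=.
  rewrite {1}(mpolywE (k := d.+1) (p := v)); last first.
    exact/dhomog_msize_le/dhomog_is_dhomog.
  apply: eq_bigr => m _ /=; rewrite /indhomog val_insubd dhomogX.
  case: eqP => // /eqP md.
  by rewrite (dhomog_nemf_coeff (dhomog_is_dhomog v) md) !scale0r.
rewrite /vcoords linear_sum; apply: eq_bigr => m _.
by rewrite linearZ.
Qed.

Lemma coord_formD i p q : coord_form i (p + q) = coord_form i p + coord_form i q.
Proof.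
by rewrite -big_split; apply: eq_bigr => m _; rewrite mcoeffD mulrDl.
Qed.

Lemma coord_formZ i a p : coord_form i (a *: p) = a * coord_form i p.
Proof.
by rewrite mulr_sumr; apply: eq_bigr => m _; rewrite mcoeffZ mulrA.
Qed.

End FormCoords.

Section FormMatrices.
Variables (r c n D : nat) (b : 'I_n -> 'I_n -> nat).

(** Unknown coefficients: one for each matrix, entry and monomial.  The common
    bound [D] on the degrees makes this a finite type. *)
Definition params := ('I_c * 'I_n * 'I_n * 'X_{1..r < D})%type.

Definition form_mx (R : nzRingType) (x : 'I_#|{: params}| -> R) (t : 'I_c) :
    'M[{mpoly R[r]}]_n :=
  \matrix_(i, j) \sum_(m : 'X_{1..r < D} | mdeg m == b i j)
    x (enum_rank ((t, i, j, m) : params)) *: 'X_[m].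

Lemma form_mx_dhomog (R : nzRingType) (x : 'I_#|{: params}| -> R) t i j :
  form_mx x t i j \is (b i j).-homog.
Proof.
by rewrite mxE; apply: rpred_sum => m md; apply: rpredZ; rewrite dhomogX.
Qed.

Lemma form_mx_surj (R : nzRingType) (M : 'I_c -> 'M[{mpoly R[r]}]_n) :
  (forall i j, (b i j < D)%N) -> (forall t i j, M t i j \is (b i j).-homog) ->
  exists x, forall t, form_mx x t = M t.
Proof.
move=> bD hM; exists (fun a => let p : params := enum_val a in
  (M p.1.1.1 p.1.1.2 p.1.2)@_(bmnm p.2)) => t.
apply/matrixP => i j; rewrite mxE.
rewrite [RHS](mpolywE (k := D)); last first.
  exact: leq_trans (dhomog_msize_le (hM t i j)) (bD i j).
rewrite [RHS](bigID (fun m : 'X_{1..r < D} => mdeg m == b i j)) /=.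
rewrite [X in _ = _ + X]big1 ?addr0 => [|m /(dhomog_nemf_coeff (hM t i j)) ->].
  by apply: eq_bigr => m _; rewrite enum_rankK.
by rewrite scale0r.
Qed.

Lemma form_mx_line (R : comNzRingType) (x u : 'I_#|{: params}| -> R) s t :
  form_mx (fun a => x a + s * u a) t = form_mx x t + s%:MP *: form_mx u t.
Proof.
apply/matrixP => i j; rewrite !mxE mulr_sumr -big_split.
by apply: eq_bigr => m _; rewrite /= scalerDl mul_mpolyC scalerA.
Qed.

Lemma map_form_mx (K : comNzRingType) (x : 'I_#|{: params}| -> K) t :
  map_mx (map_mpoly (meval x)) (form_mx (fun a => 'X_a) t) = form_mx x t.
Proof.
apply/matrixP => i j; rewrite !mxE raddf_sum; apply: eq_bigr => m _.
by rewrite /= map_mpolyZ map_mpolyX /= mevalXU.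
Qed.

End FormMatrices.

(** The membership of a form [v] in the ideal of all cofactors provides matrices
    [U t] such that [\sum_t \det (M t + s *: U t)] has first-order term [s *: v]:
    the curves required by [general_image]. *)
Lemma general_sum_of_determinants (K : numClosedFieldType) (r c n d : nat)
    (b : 'I_n -> 'I_n -> nat) (rho gam : 'I_n -> int)
    (M : 'I_c -> 'M[{mpoly K[r.+1]}]_n) :
  (forall i j, rho i - gam j = b i j) -> \sum_i rho i - \sum_j gam j = d ->
  graded (fun=> rho) gam M -> fill (gens set0 setT M) d ->
  holds_for_general (fun F : dhomog r.+1 K d =>
    exists N : 'I_c -> 'M[{mpoly K[r.+1]}]_n,
      (forall t i j, N t i j \is (b i j).-homog) /\
      (F : {mpoly K[r.+1]}) = \sum_t \det (N t)).
Proof.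
move=> rgE rgd gM fM.
pose D := (\sum_i \sum_j b i j).+1.
have bD i j : (b i j < D)%N.
  by rewrite ltnS (bigD1 i) //= (bigD1 j) //= -addnA leq_addr.
have hM t i j : M t i j \is (b i j).-homog.
  by have := gM t i j; rewrite rgE.
have [x0 x0E] := form_mx_surj bD hM.
pose S := {mpoly K[r.+1]}.
pose F x : S := \sum_t \det (@form_mx r.+1 c n D b _ x t).
have F_form x : F x \is d.-homog.
  apply: rpred_sum => t _; rewrite -is_form_dhomog -rgd.
  by apply: is_form_det => i j; rewrite rgE is_form_dhomog form_mx_dhomog.
pose G x : dhomog r.+1 K d := DHomog (F_form x).
suff [U [U1 U2 U3]] : holds_for_general (fun v => exists x, v = G x).
  exists U; split=> // v /U3[x ->]; exists (form_mx b x); split=> // t i j.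
  exact: form_mx_dhomog.
(* The same sum with indeterminate coefficients: its coefficients are the
   coordinates of the polynomial map [F]. *)
pose Fgen : {mpoly {mpoly K[#|{: params r.+1 c n D}|]}[r.+1]} :=
  \sum_t \det (@form_mx r.+1 c n D b _ (fun a => 'X_a) t).
have FgenE x : map_mpoly (meval x) Fgen = F x.
  rewrite /Fgen raddf_sum; apply: eq_bigr => t _ /=.
  by rewrite -det_map_mx map_form_mx.
apply: (@general_image _ _ _ G (fun i => \sum_(m : 'X_{1..r.+1 < d.+1})
  Fgen@_m * (form_coord i m)%:MP) x0).
  move=> x i; rewrite coord_formE /coord_form /= raddf_sum.
  apply: eq_bigr => m _ /=.
  by rewrite -FgenE mcoeff_map_mpoly mevalM mevalC.
move=> v.
have hv : is_form d (v : S) by rewrite is_form_dhomog dhomog_is_dhomog.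
have [u hu uE] := fill_forms (is_form_gens set0 setT gM) fM hv.
pose U t : 'M[S]_n := \matrix_(i, j) u (inl (t, i, j)).
have hU t i j : U t i j \is (b i j).-homog.
  rewrite mxE -is_form_dhomog; have := hu (inl (t, i, j)).
  by rewrite /= rgd opprB addrC subrK rgE.
pose dM t := \sum_i \sum_j U t i j * cofactor (M t) i j.
have vE : (v : S) = \sum_t dM t.
  rewrite uE big_sumType /= [X in _ + X]big1 ?addr0 => [|w _]; last first.
    by rewrite inE mulr0.
  rewrite pair_bigA pair_bigA /=; apply: eq_bigr => -[[t i] j] _ /=.
  by rewrite inE mxE.
have [xu xuE] := form_mx_surj bD hU.
have [Z hZ] := fin_all_exists (fun t => det_second_order (M t) (U t)).
exists xu, (fun i => (vcoords v i)%:P + 'X * \sum_(m : 'X_{1..r.+1 < d.+1})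
  (form_coord i m) *: map_poly (mcoeff m) (\sum_t Z t)).
  by move=> i; rewrite hornerD hornerC hornerM hornerX mul0r addr0.
move=> s i; rewrite !coord_formE /=.
have -> : F (fun j => x0 j + s * xu j) =
   F x0 + s *: ((v : S) + s *: (\sum_t Z t).[s%:MP]).
  have -> : F x0 = \sum_t \det (M t) by apply: eq_bigr => t _; rewrite x0E.
  rewrite vE horner_sum scaler_sumr -big_split scaler_sumr -big_split.
  apply: eq_bigr => t _; rewrite form_mx_line x0E xuE hZ -/(dM t).
  rewrite -!mul_mpolyC; set sM := s%:MP.
  set dt := \det _; set dm := dM t; set zt := (Z t).[sM].
  by rewrite /=; ring.
rewrite !coord_formD coord_formZ coord_formD coord_formZ.
rewrite hornerD hornerC hornerM hornerX; congr (_ + _ * (_ + _ * _)).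
rewrite /coord_form [RHS]horner_sum; apply: eq_bigr => m _.
by rewrite hornerZ coef_horner_mpoly mulrC.
Qed.

Theorem theorem4p5 (R : realType) (k d : nat) (A : 'M[nat]_(2 * k))
    (hk : (1 <= k)%N) (hsym : A^T = A) (hhom : homogeneous_mx A)
    (htr : \tr A = (2 * d)%N) :
  holds_for_general (fun F : dhomog 4 R[i] d =>
    exists N : 'I_k -> 'M[{mpoly R[i][4]}]_(2 * k),
      (forall t, skew_symmetric (N t) /\ has_degree_mx A (N t)) /\
      (F : {mpoly R[i][4]}) = \sum_(t < k) pfaffian (N t)).
Proof.
(* Degrees of the off-diagonal block, with a decomposition [rho i - gam j] based
   at the entry [(o, o)]. *)
pose b (i j : 'I_k) := A (lo_idx i) (hi_idx j).
have symA i j : A i j = A j i by rewrite -{1}hsym mxE.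
have bhom i j l m : (b i j + b l m = b i m + b l j)%N by apply: hhom.
have sumb : (\sum_i b i i = d)%N.
  apply/eqP; rewrite -(eqn_pmul2l (isT : (0 < 2)%N)) -htr /mxtrace.
  rewrite (reindex (cast_ord (esym (mul2n_add k)))) /=; last first.
    by exists (cast_ord (mul2n_add k)) => i _; rewrite (cast_ordK, cast_ordKV).
  rewrite big_split_ord /= -big_split big_distrr /=; apply/eqP.
  apply: eq_bigr => i _; rewrite -/(lo_idx i) -/(hi_idx i).
  have := hhom (lo_idx i) (hi_idx i) (hi_idx i) (lo_idx i).
  by rewrite [A (hi_idx i) (lo_idx i)]symA /b; lia.
pose o : 'I_k := Ordinal hk.
pose rho i : int := b i o.
pose gam j : int := (b o o)%:Z - (b o j)%:Z.
have rgE i j : rho i - gam j = b i j.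
  by rewrite /rho /gam; have := bhom i j o o; lia.
have rgd : \sum_i rho i - \sum_j gam j = d.
  rewrite -sumrB (eq_bigr (fun i => (b i i)%:Z)) => [|i _]; last exact: rgE.
  by rewrite -sumb; elim/big_rec2: _ => // i x y _ ->; rewrite PoszD.
have [M gM fM] : exists2 M : 'I_k -> 'M[{mpoly R[i][4]}]_k,
    graded (fun=> rho) gam M & fill (gens set0 setT M) d.
  rewrite -rgd; apply: (@fill_all_rows _ _ k k rho gam set0 0 1 2 3).
  - by rewrite hk leqnn.
  - by [].
  - by move=> [[|[|[|[|v]]]] hv].
  - by move=> i j; rewrite -subr_ge0 rgE.
have [U [U1 U2 U3]] := general_sum_of_determinants rgE rgd gM fM.
exists U; split=> // F /U3[B [hB ->]].
(* The sign relating pfaffian to determinant is moved into row o of each B t. *)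
pose sg : bool := shuffle k.
pose B' t : 'M[{mpoly R[i][4]}]_k :=
  \matrix_(i, j) if i == o then (-1) ^+ sg * B t o j else B t i j.
have hB' t i j : B' t i j \is (b i j).-homog.
  rewrite mxE; case: eqP => [->|_]; last exact: hB.
  by rewrite -is_form_dhomog; apply: is_form_sign; rewrite is_form_dhomog.
exists (fun t => skew_block (B' t)); split=> [t|]; last first.
  apply: eq_bigr => t _; rewrite pfaffian_skew_block.
  rewrite (det_set_row (B t) o (fun j => (-1) ^+ sg * B t o j)).
  under [X in _ = _ * X]eq_bigr => j _ do rewrite -mulrA.
  by rewrite -mulr_sumr -expand_det_row signrMK.
split; first exact: skew_block_skew.
move=> a c; have [i [->|->]] := lo_hiP a; have [j [->|->]] := lo_hiP c.
- by rewrite skew_block_lo_lo rpred0.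
- by rewrite skew_block_lo_hi hB'.
- by rewrite skew_block_hi_lo rpredN symA hB'.
- by rewrite skew_block_hi_hi rpred0.
Qed.
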